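(* Let $a>0$ and $N\ge2$ be real numbers and let $g\in V_{N,a}$. If $b>0$ is such that $(a,b)\in T=\bigcup_{m=1}^\infty T_m$, then the Gabor system $\mathcal{G}(g,a,b)$ is a frame for $L^2(\mathbb{R})$.
   Context: For $g\in L^2(\mathbb{R})$ and $a,b>0$, the Gabor system is $\mathcal{G}(g,a,b)=\{e^{2\pi i \ell b\,\cdot}g(\cdot-ka):(\ell,k)\in\mathbb{Z}^2\}$. It is a (Gabor) frame for $L^2(\mathbb{R})$ if there exist $A,B>0$ such that $A\|f\|_2^2\le \sum_{\ell,k\in\mathbb{Z}}|\langle f,e^{2\pi i \ell b\,\cdot}g(\cdot-ka)\rangle|^2\le B\|f\|_2^2$ for all $f\in L^2(\mathbb{R})$. $V_{N,a}$ is the set of continuous real-valued functions $g:\mathbb{R}\to\mathbb{R}$ with $\operatorname{supp} g=[-\frac N2,\frac N2]$ such that: (A1) $g$ is symmetric around the origin; (A2) $g$ is strictly increasing on $[-\frac N2,0]$; (A3) with $\Delta_a^2 g(x)=g(x)-2g(x-a)+g(x-2a)$: if $a<\frac N3$ then $\Delta_a^2g(x)\ge 0$ for $x\in[-\frac N2,-\frac N4+\frac{3a}{4}]$, and if $a\ge\frac N3$ then $\Delta_a^2g(x)\ge0$ for $x\in[-\frac N2,0]\cup\{-\frac N4+\frac{3a}4\}$. $T_1=\left\{(a,b)\in\mathbb{R}_+^2: a\in\left(0,\frac N2\right),\ b\in\left(0,\frac{2}{N+a}\right],\ b<\frac2N\right\}$, and for an integer $m\ge2$, $T_m=\left\{(a,b)\in\mathbb{R}_+^2: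 a\in\left(\frac{N(m-2)}{2m-3},\frac N2\right),\ b\in\left(\frac{2(m-1)}{N+(2m-3)a},\frac{2m}{N+(2m-1)a}\right],\ b<\frac2N\right\}$. *)

(* Defs.v *)
From HB Require Import structures.
From mathcomp Require Import all_boot all_order all_algebra.
From mathcomp Require Import all_classical all_reals all_analysis.
From mathcomp Require Import complex.

Set Implicit Arguments.
Unset Strict Implicit.
Unset Printing Implicit Defensive.

Import Order.TTheory GRing.Theory Num.Theory.
Import numFieldNormedType.Exports.

Local Open Scope classical_set_scope.
Local Open Scope ring_scope.
Local Open Scope complex_scope.

(* [R[i]] carries no measurable structure in the library, so a function
   [R -> R[i]] is measurable when its real and imaginary parts are, and its
   integral is taken componentwise. *)
Definition cmeasurable (R : realType) (f : R -> R[i]) : Prop :=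
  measurable_fun [set: R] (fun x => complex.Re (f x)) /\
  measurable_fun [set: R] (fun x => complex.Im (f x)).

Definition cintegral (R : realType) (f : R -> R[i]) : R[i] :=
  (\int[lebesgue_measure]_(x in [set: R]) complex.Re (f x)) +i*
  (\int[lebesgue_measure]_(x in [set: R]) complex.Im (f x)).

Definition L2norm (R : realType) (f : R -> R[i]) : \bar R :=
  'N[@lebesgue_measure R]_2%:E[EFin \o (fun x => Normc.normc (f x))]%E.

Definition in_L2 (R : realType) (f : R -> R[i]) : Prop :=
  cmeasurable f /\ (L2norm f < +oo)%E.

Definition L2inner (R : realType) (f h : R -> R[i]) : R[i] :=
  cintegral (fun x => f x * conjc (h x)).

(* The middle sum is an unconditional sum of nonnegative terms in [\bar R].
   [L2inner] is only meaningful when each [e i] is in L^2. *)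
Definition L2_frame (R : realType) (I : choiceType) (e : I -> R -> R[i]) : Prop :=
  exists A B : R, [/\ 0 < A, 0 < B &
    forall f : R -> R[i], in_L2 f ->
      (A%:E * L2norm f ^+ 2 <=
         \esum_(i in [set: I]) (Normc.normc (L2inner f (e i)) ^+ 2)%:E)%E /\
      (\esum_(i in [set: I]) (Normc.normc (L2inner f (e i)) ^+ 2)%:E <=
         B%:E * L2norm f ^+ 2)%E].

Definition cexpi (R : realType) (t : R) : R[i] := cos t +i* sin t.

Definition gabor_system (R : realType) (g : R -> R[i]) (a b : R)
    (lk : int * int) (x : R) : R[i] :=
  cexpi (2 * pi * lk.1%:~R * b * x) * g (x - lk.2%:~R * a).

Definition gabor_frame (R : realType) (g : R -> R[i]) (a b : R) : Prop :=
  L2_frame (gabor_system g a b).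

Definition diff2 (R : realType) (a : R) (g : R -> R) (x : R) : R :=
  g x - 2 * g (x - a) + g (x - 2 * a).

Definition V_window (R : realType) (N a : R) : set (R -> R) :=
  [set g : R -> R |
    [/\ continuous g,
        closure [set x | g x != 0] = `[- (N / 2), N / 2]%classic,
        forall x, g (- x) = g x,
        {in `[- (N / 2), 0] &, {homo g : x y / x < y}} &
        (a < N / 3 ->
           forall x, x \in `[- (N / 2), - (N / 4) + 3 * a / 4] ->
             0 <= diff2 a g x) /\
        (N / 3 <= a ->
           forall x, x \in `[- (N / 2), 0] \/ x = - (N / 4) + 3 * a / 4 ->
             0 <= diff2 a g x)]].

(* Only used for [1 <= m]; [m%:R - 1] etc. are subtractions in [R]. *)
Definition T_part (R : realType) (N : R) (m : nat) : set (R * R) :=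
  if m == 1%N then
    [set ab : R * R |
      [/\ 0 < ab.1, 0 < ab.2,
          ab.1 \in `]0, N / 2[,
          ab.2 \in `]0, 2 / (N + ab.1)] &
          ab.2 < 2 / N]]
  else
    [set ab : R * R |
      [/\ 0 < ab.1, 0 < ab.2,
          ab.1 \in `]N * (m%:R - 2) / (2 * m%:R - 3), N / 2[,
          ab.2 \in `]2 * (m%:R - 1) / (N + (2 * m%:R - 3) * ab.1),
                     2 * m%:R / (N + (2 * m%:R - 1) * ab.1)] &
          ab.2 < 2 / N]].

Definition T_region (R : realType) (N : R) : set (R * R) :=
  \bigcup_(m in [set m : nat | (1 <= m)%N]) T_part N m.

(* Main.v *)
Require Import Defs.
From HB Require Import structures.
From mathcomp Require Import all_boot all_order all_algebra.
From mathcomp Require Import all_classical all_reals all_analysis.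
From mathcomp Require Import complex.
From mathcomp Require Import finmap measurable_realfun ring lra zify.

Set Implicit Arguments.
Unset Strict Implicit.
Unset Printing Implicit Defensive.

Import Order.TTheory GRing.Theory Num.Theory.
Import numFieldNormedType.Exports.
Import HBSimple HBNNSimple.

Local Open Scope classical_set_scope.
Local Open Scope ring_scope.
Local Open Scope complex_scope.

(** Write M = N/2 and B = 1/b. Every point of T satisfies a < M < B, so the
window g is an even bump, positive on (-M, M) and decreasing away from 0, and
of the points x + nB, with n an integer, at most two lie in (-M, M).

Reduction to real functions. The window is real, so if f = u + iv with u and v
real, the squared coefficients of f at the frequencies l and -l add up to
twice the sum of those of u and of v: the cross terms change sign with l and
cancel ([gabor_inner_sqr], [gabor_frame_window]). It suffices to compare, for
real f, the integral of f^2 with the sum over l and k of the squares of the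
cosine and sine coefficients of f(x) g(x - ka) at the frequency l b.

Periodization. For fixed k these coefficients are the Fourier coefficients of
the B-periodic row r_k(x) = sum_n f(x + nB) g(x + nB - ka)
([line_energy_fold]). Parseval's inequality ([parseval_le]) then bounds the
integral of r_k^2 over any period by the energy at k. The direction that is
needed rests on the completeness of the trigonometric system: if p is a
trigonometric polynomial of frequencies at most L, the energy of u that is
missed by these frequencies is at most the squared distance from u to p
([parseval_approx]). The functions approximable by trigonometric polynomials
form a closed subspace of L^2. It contains the indicators of intervals because
(1 - q^n)^(2^n) tends to 1 where 0 <= q < 1/2 and to 0 where 1/2 < q <= 1
([trig_approx_ray_mid]), then those of Borel sets by Dynkin's theorem, then
everything ([trig_approx_sqint]).

Pointwise lower bound. The heart of the proof is that for ka <= p < (k + 1)a,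
f(p)^2 is at most a constant times the sum of r_(k-j)(p)^2 for 0 <= j <= t,
with t and the constant independent of f, k and p ([row_lower_bound]). Follow
the points p - jB in the rows k - j. In row k - j the window sees p - jB at
z_j = p - ka - j(B - a), which starts in [0, a) and decreases with j. As long
as z_j > B - M, row k - j involves only the values of f at p - jB and at
p - (j + 1)B, with a positive coefficient on the first, so f(p) can be
recovered from r_k(p) and f(p - B), and so on. The chain stops at the first j
with z_j <= B - M. If z_j >= 0, row k - j gives f(p - jB) alone. Otherwise it
involves f(p - jB) and f(p - (j - 1)B), and so does the previous row; the 2x2
determinant g(z) g(z') - g(z + a) g(z' - a), with z = z_(j-1) and z' = z_j, is
positive and bounded below, because g(z) >= g(z + a) and z' < 0 is closer to 0
than z' - a ([chain_bound]).

Conclusion. Integrating over the cell [ka, (k + 1)a), of length a < B, and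
summing over k gives the lower frame bound ([global_lower]). The upper one is
Bessel's inequality on an interval of length 2B, on which the frequencies l b
are still orthogonal, and which contains the support of g(x - ka)
([global_upper]). *)

(** * Square-integrable real functions on a measurable set *)

Section inner_product.
Context d (T : measurableType d) (R : realType).
Variables (mu : {measure set T -> \bar R}) (D : set T).
Hypothesis mD : measurable D.
Implicit Types (u v w : T -> R).

Definition sqint u :=
  measurable_fun D u /\ mu.-integrable D (EFin \o (fun x => u x ^+ 2)).

Definition ip u v : R := \int[mu]_(x in D) (u x * v x).

(** By 2 |uv| <= u^2 + v^2. *)
Lemma integrableM_sqint u v :
  sqint u -> sqint v -> mu.-integrable D (EFin \o (fun x => u x * v x)).
Proof.
move=> [mu_ iu] [mv iv].
apply: (@le_integrable _ _ _ mu D mD _ ((EFin \o (fun x => (u x ^+ 2)%R)) \+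
   (EFin \o (fun x => (v x ^+ 2)%R)))%E).
- by apply/measurable_EFinP; exact: measurable_funM.
- move=> x Dx /=; rewrite lee_fin.
  by rewrite (ger0_norm (_ : 0 <= _ + _)) ?addr_ge0 ?sqr_ge0// normrM -(real_normK (num_real (u x)))
    -(real_normK (num_real (v x))); have := sqr_ge0 (`|u x| - `|v x|); have := sqr_ge0 (`|u x| + `|v x|); nra.
- exact: integrableD.
Qed.

Lemma sqintD u v : sqint u -> sqint v -> sqint (fun x => u x + v x).
Proof.
move=> su sv; have iuv := integrableM_sqint su sv.
case: su sv => [mu_ iu] [mv iv]; split; first exact: measurable_funD.
rewrite (_ : _ \o _ = ((EFin \o (fun x => (u x ^+ 2)%R)) \+
   (EFin \o (fun x => (v x ^+ 2)%R)) \+ ((EFin \o (fun x => (u x * v x)%R)) \+ (EFin \o (fun x => (u x * v x)%R))))%E).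
  by apply: integrableD => //; apply: integrableD.
by apply/funext => x /=; rewrite -!EFinD; congr EFin; ring.
Qed.

Lemma sqintZ k u : sqint u -> sqint (fun x => k * u x).
Proof.
move=> [mu_ iu]; split; first exact: measurable_funM.
rewrite (_ : _ \o _ = (fun x => (k ^+ 2)%:E * (EFin \o (fun x => (u x ^+ 2)%R)) x)%E).
  exact: integrableZl.
by apply/funext => x /=; rewrite -!EFinM exprMn.
Qed.

Lemma sqintB u v : sqint u -> sqint v -> sqint (fun x => u x - v x).
Proof.
move=> su sv; rewrite (_ : (fun _ => _) = (fun x => u x + (-1) * v x)).
  by apply: sqintD => //; exact: sqintZ.
by apply/funext => x; rewrite mulN1r.
Qed.

Lemma ipC u v : ip u v = ip v u.
Proof. by apply: eq_Rintegral => x _; rewrite mulrC. Qed.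

Lemma ipDl u v w : sqint u -> sqint v -> sqint w ->
  ip (fun x => u x + v x) w = ip u w + ip v w.
Proof.
move=> su sv sw; rewrite /ip -RintegralD//; [|exact: integrableM_sqint..].
by apply: eq_Rintegral => x _; rewrite mulrDl.
Qed.

Lemma ipZl k u w : sqint u -> sqint w -> ip (fun x => k * u x) w = k * ip u w.
Proof.
move=> su sw; rewrite /ip -RintegralZl//; [|exact: integrableM_sqint..].
by apply: eq_Rintegral => x _; rewrite mulrA.
Qed.

Lemma ipBl u v w : sqint u -> sqint v -> sqint w ->
  ip (fun x => u x - v x) w = ip u w - ip v w.
Proof.
move=> su sv sw; rewrite /ip -RintegralB//; [|exact: integrableM_sqint..].
by apply: eq_Rintegral => x _; rewrite mulrBl.
Qed.

Lemma ip_ge0 u : 0 <= ip u u.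
Proof. by apply: Rintegral_ge0 => x _; rewrite -expr2 sqr_ge0. Qed.

Lemma ipBB u v : sqint u -> sqint v ->
  ip (fun x => u x - v x) (fun x => u x - v x) = ip u u - 2 * ip u v + ip v v.
Proof.
move=> su sv; have suv := sqintB su sv.
rewrite ipBl// (ipC u) (ipC v) !ipBl// (ipC v u); ring.
Qed.

Lemma ipZZ k u : sqint u ->
  ip (fun x => k * u x) (fun x => k * u x) = k ^+ 2 * ip u u.
Proof.
by move=> su; have sku := sqintZ k su; rewrite ipZl// ipC ipZl// mulrA expr2.
Qed.

Lemma EFin_ip u : sqint u -> ((ip u u)%:E = \int[mu]_(x in D) (u x ^+ 2)%:E)%E.
Proof.
move=> su; rewrite /ip /Rintegral fineK.
  by apply: eq_integral => x _; rewrite expr2.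
by apply: integrable_fin_num => //; exact: integrableM_sqint.
Qed.

Lemma sqint0 : sqint (fun _ => 0).
Proof.
split; first exact: measurable_cst.
rewrite (_ : _ \o _ = cst 0%E); first exact: integrable0.
by apply/funext => x /=; rewrite expr0n.
Qed.

Lemma sqint_sum (I : Type) (s : seq I) (F : I -> T -> R) :
  (forall i, sqint (F i)) -> sqint (fun x => \sum_(i <- s) F i x).
Proof.
move=> sF; elim: s => [|i s IH].
  by under eq_fun do rewrite big_nil; exact: sqint0.
by under eq_fun do rewrite big_cons; exact: sqintD.
Qed.

Lemma ip_suml (I : Type) (s : seq I) (F : I -> T -> R) w :
  (forall i, sqint (F i)) -> sqint w ->
  ip (fun x => \sum_(i <- s) F i x) w = \sum_(i <- s) ip (F i) w.
Proof.
move=> sF sw; elim: s => [|i s IH].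
  under eq_fun do rewrite big_nil.
  rewrite big_nil /ip (_ : (fun _ => _) = cst 0) ?Rintegral_cst ?mul0r//.
  by apply/funext => x; rewrite mul0r.
under eq_fun do rewrite big_cons.
by rewrite big_cons -IH ipDl//; exact: sqint_sum.
Qed.

(** The parallelogram identity; it replaces the triangle inequality in the
approximation arguments and avoids square roots. *)
Lemma ipDD u v : sqint u -> sqint v ->
  ip (fun x => u x + v x) (fun x => u x + v x) <= 2 * (ip u u + ip v v).
Proof.
move=> su sv; have := ip_ge0 (fun x => u x - v x); rewrite ipBB//.
have suv := sqintD su sv.
by rewrite ipDl// (ipC u (fun x => _ x + _ x)) (ipC v (fun x => _ x + _ x)) !ipDl// (ipC v u); lra.
Qed.

End inner_product.

Section dominated.
Context d (T : measurableType d) (R : realType).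
Variables (mu : {measure set T -> \bar R}) (D : set T).
Hypothesis mD : measurable D.

Lemma sqint_dominated (u g : T -> R) : measurable_fun D u -> sqint mu D g ->
  (forall x, D x -> `|u x| <= g x) -> sqint mu D u.
Proof.
move=> mu_ [mg ig] ug; split=> //.
apply: (le_integrable mD _ _ ig); first by apply/measurable_EFinP; exact: measurable_funX.
move=> x Dx /=; rewrite lee_fin !normrX lerXn2r ?nnegrE//.
by rewrite (le_trans (ug _ Dx))// ler_norm.
Qed.

(** Dominated convergence for (u - u_n)^2, which is at most (2 g)^2. *)
Lemma sqint_dominated_cvg (u_ : (T -> R)^nat) (u g : T -> R) (e : R) :
  (forall n, measurable_fun D (u_ n)) -> measurable_fun D u -> sqint mu D g ->
  (forall n x, D x -> `|u_ n x| <= g x) -> (forall x, D x -> `|u x| <= g x) ->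
  {ae mu, forall x, D x -> u_ ^~ x @ \oo --> u x} -> 0 < e ->
  exists n, ip mu D (fun x => u x - u_ n x) (fun x => u x - u_ n x) <= e.
Proof.
move=> mu_n mu_ sg ung ug uu e0.
have su : sqint mu D u by exact: sqint_dominated sg ug.
have sun n : sqint mu D (u_ n) by apply: sqint_dominated sg _ => //; exact: ung.
pose f n x := ((u x - u_ n x) ^+ 2)%:E.
have [] := @dominated_convergence _ T R mu D mD f (cst 0%E) (fun x => ((2 * g x) ^+ 2)%:E).
- move=> n; apply/measurable_EFinP; apply: measurable_funX; exact: measurable_funB.
- exact: measurable_cst.
- apply: filterS uu => x ux Dx; apply: cvg_EFin; first exact: nearW.
  have h : u x - u_ n x @[n --> \oo] --> (0 : R).
    by rewrite -(subrr (u x)); apply: cvgB; [exact: cvg_cst|exact: ux].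
  have := cvgM h h; rewrite mul0r; exact.
- by case: (sqintZ mD 2 sg).
- apply: aeW => x n Dx /=; rewrite lee_fin normrX lerXn2r ?nnegrE//.
    by rewrite mulr_ge0// (le_trans _ (ug _ Dx)).
  by rewrite (le_trans (ler_normB _ _))// mulr_natl mulr2n lerD ?ung ?ug.
- move=> _ _; rewrite integral_cst// mul0e => H.
have /cvgrPdist_le/(_ e e0)[N _ /(_ N)]/= :
  (fun n => fine (\int[mu]_(x in D) f n x)%E) @ \oo --> (0 : R).
  exact: fine_cvg.
rewrite leqnn sub0r normrN => /(_ isT) HN; exists N.
by apply: le_trans HN; rewrite /ip /Rintegral (le_trans _ (ler_norm _))//;
  under eq_integral do rewrite -expr2.
Qed.

End dominated.

(** * Trigonometric polynomials, Bessel's inequality *)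

Section trig.
Context (R : realType).
Notation mu := (@lebesgue_measure R).
Variables (b s T : R) (n : nat).
Hypotheses (b0 : 0 < b) (T0 : 0 < T) (bT : b * T = n%:R).
Local Notation D := `[s, s + T[%classic.

(** A frequency and a phase: the phases 0 and - pi / 2 give cosine and sine, and
free phases make the product of two waves a sum of two waves. *)
Definition wave (b : R) (l : int) (phi x : R) : R := cos (2 * pi * l%:~R * b * x + phi).

Let mD : @measurable _ (measurableTypeR R) D. Proof. exact: measurable_itv. Qed.

Lemma continuous_wave l phi : continuous (wave b l phi).
Proof.
move=> x; apply: continuous_comp; last exact: continuous_cos.
by apply: cvgD; [apply: cvgM; [exact: cvg_cst|exact: cvg_id]|exact: cvg_cst].
Qed.

Lemma periodic_2piz (f : R -> R) (k : int) (x : R) :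
  periodic f (pi *+ 2) -> f (x + 2 * pi * k%:~R) = f x.
Proof.
move=> pf; have H (j : nat) y : f (y + 2 * pi * j%:R) = f y.
  by rewrite mulr_natl mulr_natr (periodicn pf).
case: k => j; first exact: H.
by rewrite NegzE mulrNz mulrN -(H j.+1) subrK.
Qed.

(** The interval has length T with b T an integer, so the primitive of a wave of
nonzero frequency takes the same value at both ends. *)
Lemma int_wave l phi :
  \int[mu]_(x in D) wave b l phi x = (if l == 0 then T * cos phi else 0).
Proof.
case: eqP => [->|/eqP l0].
  rewrite (_ : wave _ _ _ = cst (cos phi)); last first.
    by apply/funext => x; rewrite /wave mulr0 !mul0r add0r.
  rewrite Rintegral_cst//= lebesgue_measure_itv/= lte_fin ltrDl T0 -EFinD /=; ring.
have iw : mu.-integrable `[s, s + T]%classic (EFin \o wave b l phi).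
  apply: continuous_compact_integrable; first exact: segment_compact.
  by apply: continuous_subspaceT => x; exact: continuous_wave.
rewrite Rintegral_itv_bndo_bndc//; last first.
  by apply: integrableS iw => //; exact: subset_itv_co_cc.
pose c := 2 * pi * l%:~R * b.
have c0 : c != 0 by rewrite /c !mulf_eq0 !negb_or pnatr_eq0 (gt_eqF (pi_gt0 R)) (gt_eqF b0) intr_eq0 l0.
pose F : R -> R := c^-1 *: (sin \o (c *: id + cst phi)).
have FE x : F x = c^-1 * sin (c * x + phi) by [].
have dF (x : R) : is_derive x (1 : R) F (wave b l phi x).
  by apply: is_derive_eq; rewrite /wave -/c addr0 /GRing.scale /= mulr1 mulrCA mulVf// mulr1.
rewrite /Rintegral (@continuous_FTC2 _ _ F)//.
- rewrite !FE /c -(periodic_2piz (l * n%:Z) (_ * s + phi) (@sinD2pi R)).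
  rewrite [X in sin X](_ : _ = 2 * pi * l%:~R * b * s + phi + 2 * pi * (l * n)%:~R) -?EFinB ?subrr//.
  by rewrite intrM -[n%:~R]bT; ring.
- by rewrite ltrDl.
- by apply: continuous_subspaceT => x; exact: continuous_wave.
- split.
  + by move=> x _; apply: ex_derive.
  + apply: cvg_at_right_filter; apply/differentiable_continuous/derivable1_diffP; exact: ex_derive.
  + apply: cvg_at_left_filter; apply/differentiable_continuous/derivable1_diffP; exact: ex_derive.
- by move=> x _; rewrite derive1E; exact: derive_val.
Qed.

Lemma measurable_wave l phi : measurable_fun D (wave b l phi).
Proof.
apply: measurable_funTS; apply: continuous_measurable_fun; exact: continuous_wave.
Qed.

Lemma wave_bound l phi x : `|wave b l phi x| <= 1.
Proof. exact: cos_max. Qed.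

Lemma sqint_bounded (M : R) (u : R -> R) : measurable_fun D u ->
  (forall x, D x -> `|u x| <= M) -> sqint mu D u.
Proof.
move=> mu_ uM; split=> //.
apply: measurable_bounded_integrable => //.
- rewrite /= lebesgue_measure_itv/=; case: ifP => _; last exact: ltry.
  by rewrite -EFinD ltry.
- exact: measurable_funX.
- exists (M ^+ 2); split; first exact: num_real.
  move=> N MN x Dx /=; rewrite normrX (le_trans _ (ltW MN))//.
  by rewrite lerXn2r ?nnegrE// ?uM// (le_trans _ (uM _ Dx)).
Qed.

Lemma sqint_wave l phi : sqint mu D (wave b l phi).
Proof.
by apply: (@sqint_bounded 1); [exact: measurable_wave|move=> x _; exact: wave_bound].
Qed.

Lemma waveM l1 l2 p1 p2 x : wave b l1 p1 x * wave b l2 p2 x =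
  2^-1 * wave b (l1 - l2) (p1 - p2) x + 2^-1 * wave b (l1 + l2) (p1 + p2) x.
Proof.
have cosM A B : cos A * cos B = 2^-1 * cos (A - B) + 2^-1 * cos (A + B) :> R.
  by rewrite cosB cosD; field.
rewrite /wave cosM intrB intrD; congr (_ * cos _ + _ * cos _); ring.
Qed.

Lemma ip_wave l1 l2 p1 p2 : ip mu D (wave b l1 p1) (wave b l2 p2) =
  T / 2 * ((l1 == l2)%:R * cos (p1 - p2) + (l1 == - l2)%:R * cos (p1 + p2)).
Proof.
rewrite /ip; under eq_Rintegral do rewrite waveM.
have iw l phi : mu.-integrable D (EFin \o wave b l phi).
  have := integrableM_sqint mD (sqint_wave l phi) (sqint_wave 0 0).
  rewrite (_ : _ \o _ = EFin \o wave b l phi)//; apply/funext => x /=.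
  by rewrite {2}/wave mulr0 !mul0r add0r cos0 mulr1.
have iw2 l phi : mu.-integrable D (EFin \o (fun x => 2^-1 * wave b l phi x)).
  rewrite (_ : _ \o _ = (fun x => (2^-1)%:E * (EFin \o wave b l phi) x)%E)//.
  exact: integrableZl.
rewrite RintegralD// !RintegralZl// !int_wave subr_eq0 addr_eq0.
by case: (l1 == l2); case: (l1 == - l2); rewrite /= !(mul1r, mul0r, mulr0, addr0, add0r); lra.
Qed.

Definition cos_coef (u : R -> R) l := ip mu D u (wave b l 0).
Definition sin_coef (u : R -> R) l := ip mu D u (wave b l (- (pi / 2))).
Definition trig_energy u l := cos_coef u l ^+ 2 + sin_coef u l ^+ 2.

(** For a uniq s this is the inner product of the partial Fourier sums of u and h
over the frequencies in s. *)
Definition fourier_form (s : seq int) u h :=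
  T^-1 * \sum_(l <- s) (cos_coef u l * cos_coef h l + sin_coef u l * sin_coef h l).

Lemma fourier_formC s' u h : fourier_form s' u h = fourier_form s' h u.
Proof.
by congr (_ * _); apply: eq_bigr => l _; rewrite mulrC [in X in _ + X]mulrC.
Qed.

Lemma fourier_form_ge0 s' u : 0 <= fourier_form s' u u.
Proof.
by apply: mulr_ge0; [rewrite invr_ge0 ltW|apply: sumr_ge0 => l _;
  rewrite -!expr2 addr_ge0 ?sqr_ge0].
Qed.

Lemma fourier_formDl s' u v h : sqint mu D u -> sqint mu D v ->
  fourier_form s' (fun x => u x + v x) h = fourier_form s' u h + fourier_form s' v h.
Proof.
move=> su sv; rewrite /fourier_form -mulrDr -big_split /=; congr (_ * _).
apply: eq_bigr => l _; rewrite /cos_coef /sin_coef !ipDl//; first ring.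
all: exact: sqint_wave.
Qed.

Lemma fourier_formZl s' k u h : sqint mu D u -> fourier_form s' (fun x => k * u x) h = k * fourier_form s' u h.
Proof.
move=> su; rewrite /fourier_form mulrCA; congr (_ * _); rewrite mulr_sumr.
apply: eq_bigr => l _; rewrite /cos_coef /sin_coef !ipZl//; first ring.
all: exact: sqint_wave.
Qed.

Inductive trigpoly : (R -> R) -> Prop :=
| trigpoly_wave l phi : trigpoly (wave b l phi)
| trigpolyD u v : trigpoly u -> trigpoly v -> trigpoly (fun x => u x + v x)
| trigpolyZ k u : trigpoly u -> trigpoly (fun x => k * u x).

Lemma trigpolyM u v : trigpoly u -> trigpoly v -> trigpoly (fun x => u x * v x).
Proof.
move=> tu tv; elim: tu => [l phi|u1 u2 _ IH1 _ IH2|k u1 _ IH].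
- elim: tv => [l' phi'|v1 v2 _ IH1 _ IH2|k v1 _ IH].
  + under eq_fun do rewrite waveM.
    by apply: trigpolyD; apply: trigpolyZ; exact: trigpoly_wave.
  + by under eq_fun do rewrite mulrDr; exact: trigpolyD.
  + by under eq_fun do rewrite mulrCA; exact: trigpolyZ.
- by under eq_fun do rewrite mulrDl; exact: trigpolyD.
- by under eq_fun do rewrite -mulrA; exact: trigpolyZ.
Qed.

Lemma trigpoly_cst k : trigpoly (fun=> k).
Proof.
rewrite (_ : (fun=> k) = (fun x => k * wave b 0 0 x)).
  by apply: trigpolyZ; exact: trigpoly_wave.
by apply/funext => x; rewrite /wave mulr0 !mul0r add0r cos0 mulr1.
Qed.

Lemma trigpolyX u k : trigpoly u -> trigpoly (fun x => u x ^+ k).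
Proof.
move=> tu; elim: k => [|k IH]; first exact: trigpoly_cst.
by under eq_fun do rewrite exprS; exact: trigpolyM.
Qed.

Lemma trigpoly_sqint u : trigpoly u -> sqint mu D u.
Proof.
elim=> [l phi|u1 u2 _ IH1 _ IH2|k u1 _ IH]; first exact: sqint_wave.
- exact: sqintD.
- exact: sqintZ.
Qed.

(** The waves of frequency l and - l span the same space, so a set of real
frequencies is handled together with its opposite. *)
Definition symseq (s : seq int) := uniq s /\ (forall l, l \in s -> - l \in s).

Lemma symseq_closure (s0 : seq int) : symseq (undup (s0 ++ map -%R s0)).
Proof.
split; first exact: undup_uniq.
move=> l; rewrite !mem_undup !mem_cat => /orP[ls|/mapP[k ks ->]].
  by rewrite map_f ?orbT.
by rewrite opprK ks.
Qed.

Lemma wave_decomp l phi x :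
  wave b l phi x = cos phi * wave b l 0 x + sin phi * - wave b l (- (pi / 2)) x.
Proof. by rewrite /wave addr0 cosBpihalf cosD; ring. Qed.

(** The reproducing property: by orthogonality only the terms l and - l survive,
and they recombine to the wave by the addition formula. *)
Lemma fourier_form_wave s' l phi h : symseq s' -> l \in s' -> sqint mu D h ->
  fourier_form s' (wave b l phi) h = ip mu D (wave b l phi) h.
Proof.
move=> [us ss] ls sh.
have ipc k : ip mu D (wave b (- k) 0) h = ip mu D (wave b k 0) h.
  apply: eq_Rintegral => x _; congr (_ * _).
  by rewrite /wave !addr0 mulrNz mulrN !mulNr cosN.
have ips k : ip mu D (wave b (- k) (- (pi / 2))) h = - ip mu D (wave b k (- (pi / 2))) h.
  rewrite -[RHS]mulN1r -ipZl//; last exact: sqint_wave.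
  apply: eq_Rintegral => x _; congr (_ * _).
  by rewrite /wave !cosBpihalf mulrNz mulrN !mulNr sinN mul1r.
rewrite /fourier_form /cos_coef /sin_coef; under eq_bigr do rewrite !ip_wave.
rewrite (eq_bigr (fun k => T / 2 * ((k == l)%:R * (cos phi * cos_coef h k - sin phi * sin_coef h k)
  + (k == - l)%:R * (cos phi * cos_coef h k + sin phi * sin_coef h k)))); last first.
  move=> k _; rewrite subr0 addr0 opprK cosBpihalf cosDpihalf (eq_sym l k).
  by rewrite (_ : (l == - k) = (k == - l)) /cos_coef /sin_coef; [ring|rewrite -eqr_oppLR eq_sym].
rewrite -mulr_sumr big_split /=.
have pick k0 (F : int -> R) : k0 \in s' -> \sum_(k <- s') (k == k0)%:R * F k = F k0.
  move=> k0s; rewrite (bigD1_seq k0)//= eqxx mul1r big1 ?addr0// => k /negPf ->.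
  by rewrite mul0r.
rewrite !pick// ?ss// /cos_coef /sin_coef (ipC _ _ h) (ipC _ _ h (wave b (-l) 0)) (ipC _ _ h (wave b l _)) (ipC _ _ h (wave b (- l) _)).
rewrite ipc ips (_ : wave b l phi = (fun x => cos phi * wave b l 0 x + (- sin phi) * wave b l (- (pi / 2)) x)).
  rewrite ipDl// ?ipZl//; try by [exact: sqint_wave|apply: sqintZ => //; exact: sqint_wave].
  by field; rewrite gt_eqF.
by apply/funext => x; rewrite wave_decomp mulrN mulNr.
Qed.

Lemma fourier_form_trigpoly p : trigpoly p -> exists s0 : seq int, forall s' h, symseq s' ->
  {subset s0 <= s'} -> sqint mu D h -> fourier_form s' p h = ip mu D p h.
Proof.
elim=> [l phi|u v tu [su IHu] tv [sv IHv]|k u tu [su IH]].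
- by exists [:: l] => s' h ss s0s sh; apply: fourier_form_wave => //; apply: s0s; rewrite inE.
- exists (su ++ sv) => s' h ss s0s sh.
  rewrite fourier_formDl ?ipDl//; try exact: trigpoly_sqint.
  by rewrite IHu ?IHv// => l ls; apply: s0s; rewrite mem_cat ls ?orbT.
- exists su => s' h ss s0s sh; rewrite fourier_formZl ?ipZl//; try exact: trigpoly_sqint.
  by rewrite IH.
Qed.

(** If the form reproduces p, then u |-> <u, u> - Q(u, u) vanishes at p and has no
cross term with p, so it is unchanged when u is replaced by u - p. *)
Lemma fourier_form_dist s' u p : sqint mu D u -> sqint mu D p ->
  fourier_form s' p u = ip mu D p u -> fourier_form s' p p = ip mu D p p ->
  ip mu D u u - fourier_form s' u u =
  ip mu D (fun x => u x - p x) (fun x => u x - p x) - fourier_form s' (fun x => u x - p x) (fun x => u x - p x).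
Proof.
move=> su sp e1 e2; have sN := sqintZ mD (-1) sp.
have -> : (fun x => u x - p x) = (fun x => u x + (-1) * p x).
  by apply/funext => x; rewrite mulN1r.
have sD := sqintD mD su sN.
rewrite !fourier_formDl// !fourier_formZl// (fourier_formC _ u) (fourier_formC _ p (fun x => _ x + _ * _ x)) !fourier_formDl// !fourier_formZl//.
rewrite !ipDl// !ipZl// (ipC _ _ u (fun x => _ x + _ * _ x)) (ipC _ _ p (fun x => _ x + _ * _ x)) !ipDl// !ipZl//.
rewrite (fourier_formC _ u p) (ipC _ _ u p) e1 e2. ring.
Qed.

Lemma fourier_formE s' u : fourier_form s' u u = T^-1 * \sum_(l <- s') trig_energy u l.
Proof. by []. Qed.

(** Taking for p the partial Fourier sum of u, u - p has no coefficient on s, and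
<u, u> - Q(u, u) is the squared norm of u - p. *)
Lemma bessel s' u : symseq s' -> sqint mu D u ->
  \sum_(l <- s') trig_energy u l <= T * ip mu D u u.
Proof.
move=> ss su.
rewrite -ler_pdivrMl// -fourier_formE -subr_ge0.
pose p x := T^-1 * \sum_(l <- s') (cos_coef u l * wave b l 0 x + sin_coef u l * wave b l (- (pi / 2)) x).
have sw l : sqint mu D (fun x => cos_coef u l * wave b l 0 x + sin_coef u l * wave b l (- (pi / 2)) x).
  by apply: sqintD => //; apply: sqintZ => //; exact: sqint_wave.
have sp : sqint mu D p by apply: sqintZ => //; exact: sqint_sum.
have pE h : sqint mu D h -> ip mu D p h = fourier_form s' u h.
  move=> sh; rewrite ipZl//; last exact: sqint_sum.
  rewrite ip_suml//; congr (_ * _); apply: eq_bigr => l _.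
  rewrite ipDl// ?ipZl//; try by [exact: sqint_wave|apply: sqintZ => //; exact: sqint_wave].
  by congr (_ * _ + _ * _); exact: ipC.
have Cp l : l \in s' -> cos_coef p l = cos_coef u l.
  by move=> ls; rewrite /cos_coef pE; [rewrite fourier_formC fourier_form_wave 1?ipC|exact: sqint_wave].
have Sp l : l \in s' -> sin_coef p l = sin_coef u l.
  by move=> ls; rewrite /sin_coef pE; [rewrite fourier_formC fourier_form_wave 1?ipC|exact: sqint_wave].
have Qp h : fourier_form s' p h = fourier_form s' u h.
  by congr (_ * _); rewrite big_seq [RHS]big_seq; apply: eq_bigr => l ls; rewrite Cp// Sp.
rewrite (fourier_form_dist su sp) ?Qp ?pE//.
rewrite [X in _ - X](_ : _ = 0) ?subr0 ?ip_ge0//.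
have -> : (fun x => u x - p x) = (fun x => u x + (-1) * p x).
  by apply/funext => x; rewrite mulN1r.
rewrite fourier_formDl//; last exact: sqintZ.
by rewrite fourier_formZl// Qp mulN1r subrr.
Qed.

(** Here <u, u> - Q(u, u) = <u - p, u - p> - Q(u - p, u - p), and Q is
nonnegative. *)
Lemma parseval_approx u p : sqint mu D u -> trigpoly p ->
  exists2 s', uniq s' & ip mu D u u <=
    T^-1 * \sum_(l <- s') trig_energy u l + ip mu D (fun x => u x - p x) (fun x => u x - p x).
Proof.
move=> su tp; have [s0 H] := fourier_form_trigpoly tp; have sp := trigpoly_sqint tp.
pose s' := undup (s0 ++ map -%R s0).
have ss : symseq s' := symseq_closure s0.
have sub : {subset s0 <= s'} by move=> l ls; rewrite mem_undup mem_cat ls.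
exists s'; first exact: undup_uniq.
rewrite -fourier_formE -lerBlDl (fourier_form_dist su sp) ?H//.
by rewrite gerBl fourier_form_ge0.
Qed.

End trig.

(** * Density of trigonometric polynomials over one period *)

Section density.
Context (R : realType).
Notation mu := (@lebesgue_measure R).
Variables (b s T : R).
Hypotheses (b0 : 0 < b) (T0 : 0 < T) (bT : b * T = 1).
Local Notation D := `[s, s + T[%classic.
Let mD : @measurable _ (measurableTypeR R) D. Proof. exact: measurable_itv. Qed.

Definition trig_approx (u : R -> R) := sqint mu D u /\ forall e : R, 0 < e ->
  exists2 p, trigpoly b p & ip mu D (fun x => u x - p x) (fun x => u x - p x) <= e.

Lemma trig_approxD u v :
  trig_approx u -> trig_approx v -> trig_approx (fun x => u x + v x).
Proof.
move=> [su au] [sv av]; split; first exact: sqintD.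
move=> e e0; have e4 : 0 < e / 4 by rewrite divr_gt0.
have [p tp Hp] := au _ e4; have [q tq Hq] := av _ e4.
have sp := trigpoly_sqint s T tp; have sq := trigpoly_sqint s T tq.
exists (fun x => p x + q x); first exact: trigpolyD.
have := ipDD mD (sqintB mD su sp) (sqintB mD sv sq).
rewrite (_ : (fun x => u x - p x + _) = (fun x => u x + v x - (p x + q x))); last first.
  by apply/funext => x; ring.
by move=> /le_trans; apply; lra.
Qed.

Lemma trig_approxZ k u : trig_approx u -> trig_approx (fun x => k * u x).
Proof.
move=> [su au]; split; first exact: sqintZ.
move=> e e0; have e4 : 0 < e / (k ^+ 2 + 1) by rewrite divr_gt0// ltr_wpDl// sqr_ge0.
have [p tp Hp] := au _ e4; have sp := trigpoly_sqint s T tp.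
exists (fun x => k * p x); first exact: trigpolyZ.
rewrite (_ : (fun x => k * u x - _) = (fun x => k * (u x - p x))); last first.
  by apply/funext => x; ring.
have sup := sqintB mD su sp.
rewrite ipZZ//; apply: le_trans (_ : (k ^+ 2 + 1) * (e / (k ^+ 2 + 1)) <= _).
  by apply: ler_pM => //; rewrite ?sqr_ge0 ?ip_ge0 ?lerDl.
by rewrite mulrC divfK// gt_eqF// ltr_wpDl// sqr_ge0.
Qed.

Lemma trigpoly_approx p : trigpoly b p -> trig_approx p.
Proof.
move=> tp; split; first exact: trigpoly_sqint tp.
move=> e e0; exists p => //; rewrite /ip.
under eq_Rintegral do rewrite subrr mul0r.
by rewrite Rintegral_cst// mul0r ltW.
Qed.

Lemma trig_approx_cst k : trig_approx (fun=> k).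
Proof. by apply: trigpoly_approx; exact: trigpoly_cst. Qed.

Lemma trig_approx_lim u : sqint mu D u -> (forall e : R, 0 < e ->
  exists2 v, trig_approx v & ip mu D (fun x => u x - v x) (fun x => u x - v x) <= e) ->
  trig_approx u.
Proof.
move=> su H; split => // e e0; have e4 : 0 < e / 4 by rewrite divr_gt0.
have [v [sv av] Hv] := H _ e4; have [p tp Hp] := av _ e4.
have sp := trigpoly_sqint s T tp.
exists p => //.
have := ipDD mD (sqintB mD su sv) (sqintB mD sv sp).
rewrite (_ : (fun x => u x - v x + _) = (fun x => u x - p x)); last first.
  by apply/funext => x; ring.
by move=> /le_trans; apply; lra.
Qed.

Lemma trig_approx_dominated_cvg (u_ : (R -> R)^nat) (u g : R -> R) :
  (forall n, trig_approx (u_ n)) ->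
  measurable_fun (D : set (measurableTypeR R)) u -> sqint mu D g ->
  (forall n x, D x -> `|u_ n x| <= g x) -> (forall x, D x -> `|u x| <= g x) ->
  {ae mu, forall x, D x -> u_ ^~ x @ \oo --> u x} -> trig_approx u.
Proof.
move=> au mu_ sg ung ug uu; apply: trig_approx_lim.
  exact: sqint_dominated sg ug.
move=> e e0; have [|n Hn] := sqint_dominated_cvg mD _ mu_ sg ung ug uu e0.
  by move=> n; case: (au n) => -[].
by exists (u_ n).
Qed.

(** By Bernoulli's inequality, (1 - q^n)^(2^n) >= 1 - (2q)^n. *)
Lemma step_cvg0 (q : R) : 0 <= q -> q < 2^-1 ->
  (fun n => (1 - q ^+ n) ^+ (2 ^ n)) @ \oo --> (1 : R).
Proof.
move=> q0 q1.
have bern (y : R) n : 0 <= y <= 1 -> 1 - n%:R * y <= (1 - y) ^+ n.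
  move=> /andP[y0 y1]; elim: n => [|n IH]; first by rewrite mul0r subr0 expr0.
  rewrite exprS -natr1.
  have : 0 <= (1 - y) ^+ n by rewrite exprn_ge0// subr_ge0.
  have : 0 <= n%:R :> R by [].
  nra.
have qn n : 0 <= q ^+ n <= 1 by rewrite exprn_ge0//= exprn_ile1//; lra.
apply: (@squeeze_cvgr _ _ _ _ (fun n => 1 - (2 * q) ^+ n) (fun=> 1)).
- apply: nearW => n; apply/andP; split.
    by rewrite exprMn (le_trans _ (bern _ _ (qn n)))// natrX.
  by have /andP[a1 a2] := qn n; rewrite exprn_ile1// ?lerBlDr ?lerDl// subr_ge0.
- rewrite -[X in _ --> X]subr0; apply: cvgB; first exact: cvg_cst.
  by apply: cvg_expr; rewrite ger0_norm; lra.
- exact: cvg_cst.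
Qed.

(** By (1 - y)^m (1 + m y) <= 1 applied to y = q^n and m = 2^n, the sequence is at
most 1 / (2q)^n. *)
Lemma step_cvg1 (q : R) : 2^-1 < q -> q <= 1 ->
  (fun n => (1 - q ^+ n) ^+ (2 ^ n)) @ \oo --> (0 : R).
Proof.
move=> q0 q1.
have bern (y : R) n : 0 <= y <= 1 -> (1 - y) ^+ n * (1 + n%:R * y) <= 1.
  move=> /andP[y0 y1]; elim: n => [|n IH]; first by rewrite mul0r addr0 expr0 mulr1.
  rewrite exprSr -natr1 (le_trans _ IH)// -mulrA ler_wpM2l ?exprn_ge0 ?subr_ge0//.
  have : 0 <= n%:R :> R by [].
  nra.
have qn n : 0 <= q ^+ n <= 1 by rewrite exprn_ge0 ?exprn_ile1//=; lra.
apply: (@squeeze_cvgr _ _ _ _ (fun=> 0) (fun n => (2 * q)^-1 ^+ n)).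
- apply: nearW => n; apply/andP; split.
    by have /andP[a1 a2] := qn n; rewrite exprn_ge0// subr_ge0.
  have q2 : 0 < (2 * q) ^+ n by rewrite exprn_gt0//; lra.
  rewrite exprVn -[leRHS]mul1r ler_pdivlMr//.
  apply: le_trans (bern _ (2 ^ n)%N (qn n)).
  apply: ler_wpM2l; first by have /andP[a1 a2] := qn n; rewrite exprn_ge0// subr_ge0.
  by rewrite natrX -exprMn ler_wpDl.
- exact: cvg_cst.
- apply: cvg_expr; rewrite ger0_norm ?invr_ge0; last by lra.
  by rewrite invf_lt1; lra.
Qed.
End density.

Section density.
Context (R : realType).
Notation mu := (@lebesgue_measure R).
Variables (b s T : R).
Hypotheses (b0 : 0 < b) (T0 : 0 < T) (bT : b * T = 1).
Local Notation D := `[s, s + T[%classic.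
Let mD : @measurable _ (measurableTypeR R) D. Proof. exact: measurable_itv. Qed.
Local Notation approx := (trig_approx b s T).

Let ae_neq (x y : R) : {ae mu, forall z, z != x /\ z != y}.
Proof.
exists [set x; y]; split.
- by apply: measurableU; exact: measurable_set1.
- by apply: null_set_setU; [exact: measurable_set1|exact: measurable_set1|exact: lebesgue_measure_set1|exact: lebesgue_measure_set1].
- move=> z /= /not_andP[]/negP; rewrite negbK => /eqP ->; [by left|by right].
Qed.

Lemma sqint_cst k : sqint mu D (cst k).
Proof. by apply: (@sqint_bounded _ _ _ `|k|); first exact: measurable_cst. Qed.

Lemma trig_approx_ext u v : approx u -> measurable_fun (D : set (measurableTypeR R)) v ->
  (forall x, D x -> u x = v x) -> approx v.
Proof.
move=> au mv uv.
have [su _] := au.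
have sv : sqint mu D v.
  split=> //; case: su => _; apply: eq_integrable => // x /set_mem Dx /=.
  by rewrite uv.
apply: (trig_approx_lim sv) => e e0; exists u => //.
rewrite /ip (@eq_Rintegral _ _ _ _ _ (cst 0)); last first.
  by move=> x /set_mem Dx; rewrite uv// subrr mul0r.
by rewrite Rintegral_cst// mul0r ltW.
Qed.

(** On the period starting at s, the ray is the interval [s, c). The product of
the sines of pi b (x - s) and pi b (x - c) is a trigonometric polynomial, negative
inside this interval and positive after it; hence q, the mean of 1 and this
product, lies in [0, 1] and is below 1/2 inside the interval, above 1/2 after it. *)
Lemma trig_approx_ray_mid c : s < c -> c < s + T -> approx (\1_(`]-oo, c[%classic)).
Proof.
move=> sc cT.
pose q x : R := 2^-1 + 2^-1 * (sin (pi * b * (x - s)) * sin (pi * b * (x - c))).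
have tq : trigpoly b q.
  rewrite (_ : q = (fun x => (2^-1 + 4^-1 * cos (pi * b * (c - s))) +
     (- 4^-1) * wave b 1 (- (pi * b * (s + c))) x)).
    by apply: trigpolyD; [exact: trigpoly_cst|apply: trigpolyZ; exact: trigpoly_wave].
  apply/funext => x; rewrite /q /wave.
  have sinM A B : sin A * sin B = 2^-1 * (cos (A - B) - cos (A + B)) :> R.
    by rewrite cosB cosD; field.
  rewrite sinM.
  rewrite [X in cos X - _](_ : _ = pi * b * (c - s)); last ring.
  rewrite [X in _ - cos X](_ : _ = 2 * pi * 1%:~R * b * x + - (pi * b * (s + c))); last ring.
  by field.
have q01 x : 0 <= q x <= 1.
  have : `|sin (pi * b * (x - s)) * sin (pi * b * (x - c))| <= 1.
    by rewrite normrM mulr_ile1// sin_max.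
  by rewrite ler_norml /q => /andP[? ?]; apply/andP; split; lra.
pose P n x : R := (1 - q x ^+ n) ^+ (2 ^ n).
have tP n : trigpoly b (P n).
  apply: trigpolyX.
  under eq_fun do rewrite -mulN1r.
  by apply: trigpolyD; [exact: trigpoly_cst|apply: trigpolyZ; exact: trigpolyX].
have P01 n x : `|P n x| <= 1.
  have /andP[a1 a2] := q01 x.
  have : 0 <= q x ^+ n <= 1 by rewrite exprn_ge0// exprn_ile1.
  move=> /andP[c1 c2].
  by rewrite ger0_norm ?exprn_ge0 ?exprn_ile1 ?subr_ge0// gerBl.
have pib : 0 < pi * b by rewrite mulr_gt0// pi_gt0.
have pibT : pi * b * T = pi by rewrite -mulrA bT mulr1.
apply: (@trig_approx_dominated_cvg _ b s T P _ (cst 1)).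
- by move=> n; exact: trigpoly_approx.
- apply: measurable_indic; exact: measurable_itv.
- exact: sqint_cst.
- by move=> n x _; exact: P01.
- by move=> x _; rewrite indicE; case: (_ \in _); rewrite /= ?normr1 ?normr0.
- apply: filterS (ae_neq s c); first exact: (ae_filter_ringOfSetsType mu).
  move=> x [xs xc] /=; rewrite in_itv/= => /andP[sx xT].
  have {xs}sx : s < x by rewrite lt_neqAle eq_sym xs.
  have s1 : 0 < sin (pi * b * (x - s)).
    apply: sin_gt0_pi; rewrite mulr_gt0 ?subr_gt0//= -[ltRHS]pibT ltr_pM2l//.
    by rewrite ltrBlDl.
  have [/andP[q0 q1]] := (q01 x).
  case: (ltrgtP x c) xc => // xc _.
  + rewrite indicE mem_set/=; last by rewrite in_itv/=.
    have s2 : sin (pi * b * (x - c)) < 0.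
      rewrite -oppr_gt0 -sinN -mulrN opprB; apply: sin_gt0_pi.
      rewrite mulr_gt0 ?subr_gt0//= -[ltRHS]pibT ltr_pM2l//.
      by rewrite ltrBlDl; lra.
    apply: step_cvg0 => //; rewrite /q.
    by have := s2; rewrite -(pmulr_rlt0 _ s1); lra.
  + rewrite indicE memNset/=; last by rewrite in_itv/= ltNge (ltW xc).
    have s2 : 0 < sin (pi * b * (x - c)).
      apply: sin_gt0_pi.
      rewrite mulr_gt0 ?subr_gt0//= -[ltRHS]pibT ltr_pM2l//.
      by rewrite ltrBlDl; lra.
    apply: step_cvg1 => //; rewrite /q.
    by have := mulr_gt0 s1 s2; lra.
Qed.

Lemma trig_approx_ray c : approx (\1_(`]-oo, c[%classic)).
Proof.
pose v : R -> R := \1_(`]-oo, c[%classic).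
have mr : measurable_fun (D : set (measurableTypeR R)) v.
  by apply: measurable_indic; exact: measurable_itv.
have [cs|sc] := leP c s.
  apply: trig_approx_ext (trig_approx_cst b s T 0) mr _ => x /=; rewrite in_itv/= => /andP[sx _].
  by rewrite /v indicE memNset//= in_itv/=; lra.
have [Tc|cT] := leP (s + T) c; last exact: trig_approx_ray_mid.
apply: trig_approx_ext (trig_approx_cst b s T 1) mr _ => x /=; rewrite in_itv/= => /andP[_ sx].
by rewrite /v indicE mem_set//= in_itv/=; lra.
Qed.

(** Dynkin's theorem for the rays, which are stable under intersection: the
sets with approximable indicator are stable under complement and, by dominated
convergence, under countable disjoint union. *)
Lemma trig_approx_indic (A : set (measurableTypeR R)) : measurable A -> approx (\1_A).
Proof.
move=> mA.
have H := @dynkin_induction _ (measurableTypeR R) (@RGenInftyO.G R) (fun A => approx (\1_A)).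
apply: H.
- exact: RGenInftyO.measurableE.
- move=> _ _ [x ->] [y ->]; exists (Num.min x y); apply/seteqP; split => z /=; rewrite !in_itv/= lt_min.
    by move=> [-> ->].
  by move=> /andP[].
- apply: trig_approx_ext (trig_approx_cst b s T 1) _ _ => //.
  by move=> x _; rewrite indicE in_setT.
- by move=> _ [x ->]; exact: trig_approx_ray.
- move=> S mS aS.
  rewrite (_ : \1_(~` S) = fun x => 1 + (-1) * \1_S x).
    apply: trig_approxD => //; [exact: trig_approx_cst|exact: trig_approxZ].
  apply/funext => x; rewrite !indicE in_setC; case: (_ \in _) => /=; ring.
- move=> F mF tF aF.
  pose G n := \big[setU/set0]_(i < n) F i.
  have mG n : measurable (G n) by apply: bigsetU_measurable.
  have mU : measurable (\bigcup_k F k) by exact: bigcupT_measurable.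
  apply: (@trig_approx_dominated_cvg _ b s T (fun n => \1_(G n)) _ (cst 1)).
  + move=> n; rewrite (_ : \1_(G n) = fun x => \sum_(i < n) \1_(F i) x).
      elim: n => [|n IH].
        by under eq_fun do rewrite big_ord0; exact: trig_approx_cst.
      by under eq_fun do rewrite big_ord_recr /=; exact: trig_approxD.
    apply/funext => x; elim: n => [|n IH].
      by rewrite /G big_ord0 indic0 big_ord0.
    rewrite big_ord_recr /= -IH /G big_ord_recr /= !indicE in_setU.
    case: (boolP (x \in \big[_/_]_(_ < _) _)) => /=; last by rewrite add0r.
    case: (boolP (x \in F n)) => /=; last by rewrite addr0.
    move=> /set_mem Fnx /set_mem; rewrite -bigcup_mkord => -[k /= kn Fkx].
    have /trivIsetP/(_ k n I I) := tF; rewrite (ltn_eqF kn) => /(_ isT) /seteqP[+ _].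
    by move=> /(_ x) [].
  + exact: measurable_indic.
  + exact: sqint_cst.
  + by move=> n x _; rewrite indicE; case: (_ \in _); rewrite /= ?normr1 ?normr0.
  + by move=> x _; rewrite indicE; case: (_ \in _); rewrite /= ?normr1 ?normr0.
  + apply: (@aeW _ (measurableTypeR R)) => x _; apply: cvg_near_cst.
    case: (pselect ((\bigcup_k F k) x)) => [[k _ Fkx]|nF].
      exists k.+1 => // n /= kn; rewrite !indicE !mem_set//; first by exists k.
      by rewrite /G -bigcup_mkord; exists k.
    apply: nearW => n; rewrite !indicE !memNset//.
    by rewrite /G -bigcup_mkord => -[k _ Fk]; apply: nF; exists k.
- by move: mA; rewrite RGenInftyO.measurableE.
Qed.

(** An increasing sequence of simple functions converges to u and is dominated
by u. *)
Lemma trig_approx_ge0 (u : measurableTypeR R -> R) : measurable_fun setT u -> (forall x, 0 <= u x) ->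
  sqint mu D u -> approx u.
Proof.
move=> mu_ u0 su.
have meu : measurable_fun setT (EFin \o u) by exact/measurable_EFinP.
pose f := nnsfun_approx measurableT meu.
have cvf x : f n x @[n --> \oo] --> u x.
  have meu0 (t : measurableTypeR R) : setT t -> (0 <= (EFin \o u) t)%E.
    by move=> _ /=; rewrite lee_fin.
  have := cvg_nnsfun_approx measurableT meu meu0 (x := x) I.
  exact: fine_cvg.
have fu n x : f n x <= u x.
  rewrite -(cvg_lim _ (cvf x))//; apply: nondecreasing_cvgn_le.
    by move=> k m km; have /lefP/(_ x) := nd_nnsfun_approx measurableT meu km.
  by apply/cvg_ex; exists (u x).
apply: (@trig_approx_dominated_cvg _ b s T f _ u) => //.
- move=> n.
  rewrite (_ : (f n : R -> R) = fun x => \sum_(y <- fset_set (range (f n)))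
      (y * \1_(f n @^-1` [set y]) x)); last first.
    by apply/funext => x; rewrite fimfunE fsbig_finite.
  have: forall r : seq R, approx (fun x => \sum_(y <- r) (y * \1_(f n @^-1` [set y]) x)); last exact.
  elim=> [|y r IH].
    by under eq_fun do rewrite big_nil; exact: trig_approx_cst.
  under eq_fun do rewrite big_cons; apply: trig_approxD => //.
  apply: trig_approxZ => //; exact: trig_approx_indic.
- exact: measurable_funTS.
- by move=> n x _; rewrite ger0_norm// fun_ge0.
- by move=> x _; rewrite ger0_norm.
- by apply: (@aeW _ (measurableTypeR R)) => x _; exact: cvf.
Qed.

Lemma trig_approx_sqint (u : measurableTypeR R -> R) : measurable_fun setT u ->
  sqint mu D u -> approx u.
Proof.
move=> mu_ su.
pose up := fun x => Num.max (u x) 0; pose um := fun x => Num.max (- u x) 0.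
have mup : measurable_fun setT up by apply: measurable_maxr.
have mum : measurable_fun setT um by apply: measurable_maxr => //; exact: measurableT_comp.
have sa : sqint mu D (fun x => `|u x|).
  case: su => mu' iu; split; first exact: measurableT_comp.
  rewrite (_ : _ \o _ = EFin \o (fun x => u x ^+ 2))//.
  by apply/funext => x /=; rewrite real_normK ?num_real.
have sup : sqint mu D up.
  apply: (sqint_dominated mD _ sa); first exact: measurable_funTS.
  by move=> x _; rewrite /up ger0_norm ?le_max ?lexx ?orbT// ge_max ler_norm normr_ge0.
have sum : sqint mu D um.
  apply: (sqint_dominated mD _ sa); first exact: measurable_funTS.
  by move=> x _; rewrite /um ger0_norm ?le_max ?lexx ?orbT// ge_max -normrN ler_norm normr_ge0.
rewrite (_ : u = (fun x => up x + (-1) * um x)).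
  apply: trig_approxD; last apply: trig_approxZ; by [|apply: trig_approx_ge0 => // x; rewrite le_max lexx orbT].
apply/funext => x; rewrite /up /um; have [ux|ux] := leP (u x) 0.
  by rewrite max_l ?oppr_ge0//; ring.
by rewrite max_r ?oppr_le0 1?ltW//; ring.
Qed.

End density.

(** * Fourier coefficients over the whole line and periodization *)

Section shift.
Context (R : realType).
Notation mu := (@lebesgue_measure R).
Implicit Types h : R.

Let shift h (x : measurableTypeR R) : measurableTypeR R := (x + h)%R.

Let measurable_shift h : measurable_fun setT (shift h).
Proof. exact: measurable_funD. Qed.

(** Both measures agree on half-open intervals, which determine the measure. *)
Lemma lebesgue_measure_shift h (A : set (measurableTypeR R)) : measurable A ->
  pushforward mu (shift h) A = mu A.
Proof.
move=> mA; apply/esym/lebesgue_measure_unique => //=.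
move=> _ [[x y]] _ <-.
rewrite /pushforward (_ : shift h @^-1` _ = `](x - h), (y - h)]%classic); last first.
  by apply/seteqP; split => z /=; rewrite /shift /= !in_itv/= ltrBlDr lerBrDr.
rewrite /= !lebesgue_measure_itv/= !lte_fin ltrD2r; case: ifP => // _.
by rewrite -!EFinB; congr EFin; ring.
Qed.

Lemma integral_shift h (D : set (measurableTypeR R)) (f : measurableTypeR R -> \bar R) :
  measurable D -> measurable_fun setT f ->
  (\int[mu]_(x in D) f x = \int[mu]_(x in shift h @^-1` D) f (x + h)%R)%E.
Proof.
move=> mD mf.
have key (k : measurableTypeR R -> \bar R) : measurable_fun setT k -> (forall x, (0 <= k x)%E) ->
    (\int[mu]_(x in D) k x = \int[mu]_(x in shift h @^-1` D) (k \o shift h) x)%E.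
  move=> mk k0; rewrite -[RHS]ge0_integral_pushforward//; last exact: measurable_funTS.
  apply: eq_measure_integral => //= A mA _; apply/esym; exact: lebesgue_measure_shift.
rewrite integralE [RHS]integralE; congr (_ - _)%E.
  by rewrite key//; [rewrite -funepos_comp|exact: measurable_funepos].
by rewrite key//; [rewrite -funeneg_comp|exact: measurable_funeneg].
Qed.

Lemma Rintegral_shift h (c T : R) (f : measurableTypeR R -> R) : measurable_fun setT f ->
  \int[mu]_(x in `[c + h, c + h + T[) f x = \int[mu]_(x in `[c, c + T[) f (x + h).
Proof.
move=> mf; rewrite /Rintegral (@integral_shift h)//; last exact/measurable_EFinP.
congr (fine (integral _ _ _)).
by apply/seteqP; split => z /=; rewrite /shift /= !in_itv/= lerD2r addrAC ltrD2r.
Qed.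

End shift.

Section line.
Context (R : realType).
Notation mu := (@lebesgue_measure R).
Implicit Types (b B s T : R) (F : measurableTypeR R -> R).

Lemma sqintS (A E : set (measurableTypeR R)) F : measurable A -> measurable E ->
  E `<=` A -> sqint mu A F -> sqint mu E F.
Proof.
move=> mA mE EA [mF iF]; split; first exact: measurable_funS mF.
exact: integrableS iF.
Qed.

Lemma parseval_le b s T F : 0 < b -> 0 < T -> b * T = 1 ->
  measurable_fun setT F -> sqint mu `[s, s + T[ F ->
  ((ip mu `[s, s + T[ F F)%:E <=
    T^-1%:E * \esum_(l in [set: int]) (trig_energy b s T F l)%:E)%E.
Proof.
move=> b0 T0 bT mF sF; apply/lee_addgt0Pr => e e0.
have [_ /(_ e e0)[p tp Hp]] := trig_approx_sqint b0 bT mF sF.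
have bT1 : b * T = 1%:R by [].
have [s' us' Hs'] := parseval_approx b0 T0 bT1 sF tp.
apply: (@le_trans _ _ (T^-1%:E * (\sum_(l <- s') trig_energy b s T F l)%:E + e%:E)%E).
  by rewrite -EFinM -EFinD lee_fin (le_trans Hs')// lerD2l.
rewrite leeD2r// lee_pmul2l ?lte_fin ?invr_gt0//.
apply: esum_ge; exists [set` s'].
  by split => //; exact: finite_seq.
by rewrite -sumEFin fsbig_seq.
Qed.

Definition line_coef b F (l : int) (phi : R) : R :=
  \int[mu]_x (F x * wave b l phi x).

(** The squared modulus of the integral of F(x) exp(2 i pi l b x). *)
Definition line_energy b F l :=
  line_coef b F l 0 ^+ 2 + line_coef b F l (- (pi / 2)) ^+ 2.

Lemma Rintegral_support (A : set (measurableTypeR R)) (G : measurableTypeR R -> R) :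
  (forall x, ~ A x -> G x = 0) -> \int[mu]_x G x = \int[mu]_(x in A) G x.
Proof.
move=> G0; rewrite [RHS]Rintegral_mkcond; apply: eq_Rintegral => x _.
rewrite patchE; case: ifPn => // /negP xA; apply: G0; apply: contra_not xA; exact: mem_set.
Qed.

Lemma line_energyE b c T F l : (forall x, ~ `[c, c + T[%classic x -> F x = 0) ->
  line_energy b F l = trig_energy b c T F l.
Proof.
move=> F0; rewrite /line_energy /line_coef /trig_energy /cos_coef /sin_coef /ip.
by rewrite !(@Rintegral_support `[c, c + T[%classic)// => x /F0 ->; rewrite mul0r.
Qed.

(** Every finite set of frequencies is contained in a symmetric one. *)
Lemma esum_bessel b c T n F : 0 < b -> 0 < T -> b * T = n%:R ->
  sqint mu `[c, c + T[ F -> (forall x, ~ `[c, c + T[%classic x -> F x = 0) ->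
  (\esum_(l in [set: int]) (line_energy b F l)%:E <= (T * ip mu `[c, c + T[ F F)%:E)%E.
Proof.
move=> b0 T0 bT sF F0; apply: ub_ereal_sup => _ [A [fA _] <-].
rewrite fsbig_finite//= sumEFin lee_fin.
pose s' := undup (fset_set A ++ map -%R (fset_set A)).
have ss : symseq s' := symseq_closure (fset_set A).
apply: le_trans (bessel b0 T0 bT ss sF).
under eq_bigr do rewrite (line_energyE _ _ F0).
rewrite [leRHS](bigID (fun l => l \in fset_set A))/= -[leLHS]addr0 lerD//; last first.
  by apply: sumr_ge0 => l _; rewrite addr_ge0 ?sqr_ge0.
rewrite -[leRHS]big_filter le_eqVlt; apply/orP; left; apply/eqP/perm_big/uniq_perm.
- exact: fset_uniq.
- by rewrite filter_uniq// undup_uniq.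
- move=> l; rewrite mem_filter mem_undup mem_cat; case: (l \in _) => //=.
Qed.

Lemma Rintegral_slices T c (n : nat) (G : measurableTypeR R -> R) : 0 < T ->
  measurable_fun setT G -> mu.-integrable setT (EFin \o G) ->
  \int[mu]_(x in `[c, c + n%:R * T[) G x =
    \sum_(0 <= i < n) \int[mu]_(x in `[c, c + T[) G (x + i%:R * T).
Proof.
move=> T0 mG iG; elim: n => [|n IH].
  by rewrite mul0r addr0 big_geq// set_itvco0 Rintegral_set0.
rewrite big_nat_recr//= -IH -Rintegral_shift//.
have -> : `[c, c + n.+1%:R * T[%classic = `[c, c + n%:R * T[%classic `|`
    `[c + n%:R * T, c + n%:R * T + T[%classic.
  have nT : 0 <= n%:R * T by rewrite mulr_ge0// ltW.
  apply/seteqP; split => x /=; rewrite !in_itv/= -natr1 mulrDl mul1r addrA.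
    by move=> /andP[cx xT]; case: (ltP x (c + n%:R * T)) => h; [left|right]; rewrite ?cx.
  by move=> [] /andP[h1 h2]; apply/andP; split; lra.
rewrite Rintegral_setU; [by []|exact: measurable_itv|exact: measurable_itv| |].
- by apply: integrableS iG => //; apply: measurableU; exact: measurable_itv.
- apply/disj_set2P; rewrite -subset0 => x [] /=; rewrite !in_itv/= => /andP[_ h1] /andP[h2 _]; lra.
Qed.

End line.

Section fold.
Context (R : realType).
Notation mu := (@lebesgue_measure R).
Implicit Types (b B s T : R) (F : measurableTypeR R -> R).

Lemma measurable_fun_shift h F : measurable_fun setT F ->
  measurable_fun setT (fun x : measurableTypeR R => F (x + h)).
Proof.
move=> mF; apply: (@measurableT_comp _ _ _ _ _ _ F) => //.
exact: measurable_funD.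
Qed.

Lemma sqint_shift h F : sqint mu setT F ->
  sqint mu setT (fun x : measurableTypeR R => F (x + h)).
Proof.
move=> [mF iF]; have mFh := measurable_fun_shift h mF; split=> //.
apply/integrableP; split; first by apply/measurable_EFinP; exact: measurable_funX.
move/integrableP : iF => [_]; congr (_ < _)%E.
rewrite (@integral_shift _ h)//; apply: measurableT_comp => //.
by apply/measurable_EFinP; exact: measurable_funX.
Qed.

Lemma wave_periodic b B l phi (z : int) x : b * B = 1 ->
  wave b l phi (x + z%:~R * B) = wave b l phi x.
Proof.
move=> bB; rewrite /wave -(periodic_2piz (l * z) (_ * x + phi) (@cosD2pi R)).
congr cos; rewrite intrM -[X in X * z%:~R]mulr1 -bB; ring.
Qed.

Lemma integrable_line b c T F l phi : sqint mu setT F ->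
  (forall x, ~ `[c, c + T[%classic x -> F x = 0) ->
  mu.-integrable setT (EFin \o (fun x => F x * wave b l phi x)).
Proof.
move=> sF F0; pose E := `[c, c + T[%classic.
have mE : @measurable _ (measurableTypeR R) E by exact: measurable_itv.
pose G (x : measurableTypeR R) := F x * wave b l phi x.
rewrite (_ : EFin \o _ = (EFin \o G) \_ E).
  apply: (integrable_mkcond _ mE).1.
  by apply: integrableM_sqint => //; [exact: sqintS sF|exact: sqint_wave].
apply/funext => x; rewrite patchE; case: ifPn => // /negP xE /=.
by rewrite F0 ?mul0r//; apply: contra_not xE; exact: mem_set.
Qed.

(** The waves have period B, so integrating over the line amounts to
integrating the sum of the translates of F over one period. Finitely many
translates suffice because F has bounded support. *)
Lemma line_energy_fold b B s (L : nat) F l : 0 < B -> b * B = 1 -> sqint mu setT F ->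
  (forall x, ~ `[s - L%:R * B, s - L%:R * B + (L + L.+1)%:R * B[%classic x -> F x = 0) ->
  line_energy b F l =
  trig_energy b s B (fun x => \sum_(0 <= i < L + L.+1) F (x + (i%:R - L%:R) * B)) l.
Proof.
move=> B0 bB sF F0.
pose E := `[s - L%:R * B, s - L%:R * B + (L + L.+1)%:R * B[%classic.
have mE : @measurable _ (measurableTypeR R) E by exact: measurable_itv.
have mD : @measurable _ (measurableTypeR R) `[s, s + B[%classic by exact: measurable_itv.
suff key phi : line_coef b F l phi =
    ip mu `[s, s + B[ (fun x => \sum_(0 <= i < L + L.+1) F (x + (i%:R - L%:R) * B)) (wave b l phi).
  by rewrite /line_energy !key.
pose G (x : measurableTypeR R) := F x * wave b l phi x.
have G0 x : ~ E x -> G x = 0 by move=> /F0 Fx; rewrite /G Fx mul0r.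
have mw : measurable_fun setT (wave b l phi : measurableTypeR R -> R).
  by apply: continuous_measurable_fun; exact: continuous_wave.
have mG : measurable_fun setT G by apply: measurable_funM => //; case: sF.
have iG : mu.-integrable setT (EFin \o G) by exact: integrable_line F0.
rewrite /line_coef (@Rintegral_support _ E G G0) Rintegral_slices//.
rewrite ip_suml//; last 2 first.
- move=> i; apply: sqintS (sqint_shift _ sF) => //.
- exact: sqint_wave.
apply: eq_bigr => i _.
have sE : s = s - L%:R * B + L%:R * B by rewrite subrK.
rewrite /ip [in RHS]sE [RHS]Rintegral_shift; last first.
  by apply: measurable_funM => //; apply: measurable_fun_shift; case: sF.
apply: eq_Rintegral => x _; rewrite /G.
rewrite (_ : x + L%:R * B + (i%:R - L%:R) * B = x + i%:R * B); last by ring.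
congr (_ * _).
by rewrite (@wave_periodic _ _ _ _ i%:Z)// (@wave_periodic _ _ _ _ L%:Z).
Qed.

End fold.

(** * The pointwise lower bound for the periodized rows *)

Section chain.
Context (R : realType).
Variables (g : R -> R) (a M B : R).
Hypotheses (a0 : 0 < a) (aM : a < M) (MB : M < B).
Hypothesis gC : continuous g.
Hypothesis gN : forall x, g (- x) = g x.
Hypothesis g0 : forall x, M <= `|x| -> g x = 0.
Hypothesis gpos : forall x, `|x| < M -> 0 < g x.
Hypothesis gmono : forall x y, `|x| < `|y| -> `|x| < M -> g y < g x.

Lemma window_ge0 x : 0 <= g x.
Proof. by case: (ltP `|x| M) => [/gpos/ltW|/g0->]. Qed.

Lemma window_le x y : `|x| <= `|y| -> g y <= g x.
Proof.
case: (ltP `|x| M) => [xM|xM xy]; last by rewrite (g0 xM) g0 ?(le_trans xM).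
rewrite le_eqVlt => /predU1P[/eqP|xy]; last exact/ltW/gmono.
by rewrite eqr_norm2 => /predU1P[->//|/eqP ->]; rewrite gN.
Qed.

(** The difference g(v) - g(v - a) is continuous and positive on a compact
interval. At the left end v - a = - M and g(v - a) = 0. *)
Lemma window_gap : exists2 c, 0 < c &
  forall v, a - M <= v -> v <= 0 -> c <= g v - g (v - a).
Proof.
have a1 := a0; have a2 := aM; have a3 := MB.
have cont : {within `[a - M, 0], continuous (fun v => g v - g (v - a))}.
  apply: continuous_subspaceT => v; apply: cvgB; first exact: gC.
  by apply: (@continuous_comp _ _ _ (fun v => v - a) g);
    [apply: cvgB; [exact: cvg_id|exact: cvg_cst]|exact: gC].
have le0 : a - M <= 0 by rewrite subr_le0 ltW.
have [v0 v0in vmin] := EVT_min le0 cont.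
exists (g v0 - g (v0 - a)).
  move: v0in; rewrite in_itv/= => /andP[v1 v2]; rewrite subr_gt0.
  by apply: gmono; rewrite !ler0_norm//; lra.
by move=> v v1 v2; apply: vmin; rewrite in_itv/= v1 v2.
Qed.

(** The value u_i stands for f(p - iB) and r_j for the row k - j at p, with
z = p - ka: the point p - iB is seen by the row k - j at z - j (B - a) + (j - i) B.
For z - j (B - a) in (a - M, a) only i = j - 1, j, j + 1 fall in (- M, M), and for
j = 0 the index i = - 1 does not. Beyond this range the row is left unspecified. *)
Definition chain_rows (t : nat) (z : R) (u r : nat -> R) :=
  r 0%N = u 0%N * g z + u 1%N * g (z - B) /\
  forall j, (j < t)%N -> a - M < z - j.+1%:R * (B - a) ->
    r j.+1 = u j * g (z - j.+1%:R * (B - a) + B) +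
             u j.+1 * g (z - j.+1%:R * (B - a)) +
             u j.+2 * g (z - j.+1%:R * (B - a) - B).

(** Induction on the length t of the chain, passing from p to p - B and from the
row k to the row k - 1. The step distinguishes whether the row determines u_0
(z <= B - M), the chain goes on (z' >= 0), or two rows determine u_0 and u_1
(z' < 0), where z' = z - (B - a). *)
Lemma chain_bound t : exists2 C, 0 < C & forall z u r, 0 <= z -> z < a ->
  z <= B - M + t%:R * (B - a) -> chain_rows t z u r ->
  u 0%N ^+ 2 <= C * \sum_(j < t.+1) r j ^+ 2.
Proof.
have a1 := a0; have a2 := aM; have a3 := MB.
have [c c0 gap] := window_gap.
pose G := g 0; pose ga := g a.
have G0 : 0 < G by apply: gpos; rewrite normr0; lra.
have ga0 : 0 < ga by apply: gpos; rewrite gtr0_norm.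
have gG x : 0 <= g x <= G.
  by rewrite window_ge0 window_le// normr0.
have gz z : 0 <= z -> z < a -> ga <= g z.
  by move=> z0 za; apply: window_le; rewrite (ger0_norm z0) (gtr0_norm a0) ltW.
have sq_le (x y : R) : 0 <= x -> x <= y -> x ^+ 2 <= y ^+ 2.
  by move=> x0 xy; rewrite lerXn2r// nnegrE (le_trans x0).
have single z u0 u1 r0 : 0 <= z -> z < a -> z <= B - M ->
    r0 = u0 * g z + u1 * g (z - B) -> u0 ^+ 2 <= ga ^- 2 * r0 ^+ 2.
  move=> z0 za zBM ->; rewrite (@g0 (z - B)) ?mulr0 ?addr0; last by rewrite ler0_norm; lra.
  rewrite mulrC ler_pdivlMr ?exprn_gt0// exprMn ler_wpM2l ?sqr_ge0//.
  by apply: sq_le; [exact: ltW|exact: gz].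
elim: t => [|t [C C0 IH]].
  exists (ga ^- 2); first by rewrite invr_gt0 exprn_gt0.
  move=> z u r z0 za zB [e0 _]; rewrite big_ord1.
  by apply: single e0 => //; move: zB; rewrite mul0r addr0.
pose C1 := ga ^- 2; pose C2 := ga ^- 2 * 2 * (1 + G ^+ 2 * C).
pose C3 := (ga * c) ^- 2 * (2 * G ^+ 2).
have C10 : 0 < C1 by rewrite invr_gt0 exprn_gt0.
have C20 : 0 < C2.
  by rewrite /C2 mulr_gt0 ?mulr_gt0 ?invr_gt0 ?exprn_gt0// ltr_wpDr// mulr_ge0 ?sqr_ge0// ltW.
have C30 : 0 < C3.
  by rewrite mulr_gt0 ?mulr_gt0 ?invr_gt0 ?exprn_gt0// mulr_gt0.
exists (C1 + C2 + C3); first by rewrite !addr_gt0.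
move=> z u r z0 za zB [e0 e1].
have S0 : 0 <= \sum_(j < t) r j.+2 ^+ 2 by apply: sumr_ge0 => j _; exact: sqr_ge0.
rewrite big_ord_recl big_ord_recl /=.
rewrite (_ : \sum_(i < t) _ = \sum_(j < t) r j.+2 ^+ 2); last first.
  by apply: eq_bigr => i _; congr (r _ ^+ 2).
rewrite (_ : bump 0 0 = 1)%N//.
set S := \sum_(j < t) _ in S0 *.
have r00 := sqr_ge0 (r 0%N); have r10 := sqr_ge0 (r 1%N).
have finish (C' : R) : 0 <= C' <= C1 + C2 + C3 -> u 0%N ^+ 2 <= C' * (r 0%N ^+ 2 + (r 1%N ^+ 2 + S)) ->
  u 0%N ^+ 2 <= (C1 + C2 + C3) * (r 0%N ^+ 2 + (r 1%N ^+ 2 + S)).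
  by move=> /andP[C'0 C'1] /le_trans; apply; apply: ler_wpM2r => //; rewrite !addr_ge0.
(* If z <= B - M, then z - B is outside the support and u_1 does not occur in
   r_0. *)
have [zBM|zBM] := leP z (B - M).
  apply: (finish C1); first by lra.
  apply: (le_trans (single _ _ _ _ z0 za zBM e0)); rewrite ler_wpM2l ?(ltW C10)//.
  by rewrite lerDl addr_ge0.
have gzp : 0 < g z by apply: lt_le_trans (gz _ z0 za).
pose z' := z - (B - a).
have z'E : z - 1%:R * (B - a) = z' by rewrite mul1r.
have az' : a - M < z' by rewrite /z'; lra.
have := e1 0%N isT; rewrite z'E => /(_ az') r1.
(* Next row at z' >= 0: the chain continues from u_1. *)
have [z'0|z'0] := leP 0 z'.
  have IH' := IH z' (fun j => u j.+1) (fun j => r j.+1) z'0.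
  have {IH'} : u 1%N ^+ 2 <= C * \sum_(j < t.+1) r j.+1 ^+ 2.
    apply: IH'; [by rewrite /z'; lra|by move: zB; rewrite -natr1 /z'; lra|split].
      rewrite r1 (@g0 (z' + B)) ?mulr0 ?add0r//.
      by rewrite ger0_norm; rewrite /z' in z'0 *; lra.
    move=> j jt; rewrite (_ : z' - j.+1%:R * (B - a) = z - j.+2%:R * (B - a)); last first.
      by rewrite /z' -!natr1; ring.
    by move=> h; rewrite e1.
  rewrite big_ord_recl /= (_ : \sum_(i < t) _ = S); last first.
    by apply: eq_bigr => i _; congr (r _ ^+ 2).
  move=> u1; apply: (finish C2); first by lra.
  have -> : u 0%N = (r 0%N - u 1%N * g (z - B)) / g z.
    by rewrite e0 addrK mulfK// gt_eqF.
  set X := r 0%N - _.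
  have X2 : X ^+ 2 <= 2 * (r 0%N ^+ 2 + G ^+ 2 * u 1%N ^+ 2).
    have : (u 1%N * g (z - B)) ^+ 2 <= G ^+ 2 * u 1%N ^+ 2.
      rewrite exprMn mulrC ler_wpM2r ?sqr_ge0// sq_le//;
      by have /andP[] := gG (z - B).
    have := sqr_ge0 (r 0%N + u 1%N * g (z - B)); rewrite /X sqrrB sqrrD; lra.
  have GC : G ^+ 2 * u 1%N ^+ 2 <= G ^+ 2 * C * (r 1%N ^+ 2 + S).
    by rewrite -mulrA ler_wpM2l ?sqr_ge0.
  have X3 : X ^+ 2 <= 2 * (1 + G ^+ 2 * C) * (r 0%N ^+ 2 + (r 1%N ^+ 2 + S)).
    have : 0 <= G ^+ 2 * C * r 0%N ^+ 2 by apply: mulr_ge0 (sqr_ge0 _); exact: mulr_ge0 (sqr_ge0 _) (ltW C0).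
    move: X2 GC; lra.
  rewrite exprMn exprVn mulrC /C2 -!mulrA; apply: ler_pM => //.
  - by rewrite invr_ge0 sqr_ge0.
  - by rewrite sqr_ge0.
  - by rewrite lef_pV2 ?posrE ?exprn_gt0// sq_le ?gz// ltW.
  - by move: X3; rewrite -!mulrA.
(* Next row at z' < 0: by Cramer's rule from r_0 and r_1, as z - B = z' - a and
   z' + B = z + a. *)
apply: (finish C3); first by lra.
have z'B : g (z' - B) = 0 by apply: g0; rewrite ler0_norm; lra.
rewrite z'B mulr0 addr0 in r1.
have zB' : z - B = z' - a by rewrite /z'; lra.
have zB'' : z' + B = z + a by rewrite /z'; lra.
rewrite zB' in e0; rewrite zB'' in r1.
pose det := g z * g z' - g (z + a) * g (z' - a).
have detc : ga * c <= det.
  apply: (@le_trans _ _ (g z * (g z' - g (z' - a)))).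
    by apply: ler_pM; [exact: ltW|exact: ltW|exact: gz|apply: gap; lra].
  rewrite /det mulrBr lerB// ler_wpM2r ?window_ge0// window_le// !ger0_norm; lra.
have det0 : 0 < det by apply: lt_le_trans detc; rewrite mulr_gt0.
have -> : u 0%N = (g z' * r 0%N - g (z' - a) * r 1%N) / det.
  apply: (mulIf (lt0r_neq0 det0)).
  rewrite divfK ?lt0r_neq0// e0 r1 /det; ring.
set X := g z' * _ - _.
have X2 : X ^+ 2 <= 2 * G ^+ 2 * (r 0%N ^+ 2 + (r 1%N ^+ 2 + S)).
  have H w y : (g w * y) ^+ 2 <= G ^+ 2 * y ^+ 2.
    rewrite exprMn ler_wpM2r ?sqr_ge0// sq_le//;
      by have /andP[] := gG w.
  have h1 := H z' (r 0%N); have h2 := H (z' - a) (r 1%N).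
  have := sqr_ge0 (g z' * r 0%N + g (z' - a) * r 1%N).
  have : 0 <= G ^+ 2 * S by rewrite mulr_ge0 ?sqr_ge0.
  rewrite /X sqrrB sqrrD; lra.
rewrite exprMn exprVn mulrC /C3 -!mulrA; apply: ler_pM => //.
- by rewrite invr_ge0 sqr_ge0.
- by rewrite sqr_ge0.
- by rewrite lef_pV2 ?posrE ?exprn_gt0// ?mulr_gt0// sq_le// ltW// mulr_gt0.
- by move: X2; rewrite -!mulrA.
Qed.
End chain.

Lemma big_nat_window3 (V : zmodType) (F : nat -> V) (n K : nat) :
  (n.+2 < K)%N -> (forall i, (i < n)%N || (n.+2 < i)%N -> F i = 0) ->
  \sum_(0 <= i < K) F i = F n + F n.+1 + F n.+2.
Proof.
move=> nK F0.
rewrite (@big_cat_nat _ _ _ n)//=; last by lia.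
rewrite big_nat_cond big1 ?add0r; last by move=> i /andP[/andP[_ h] _]; rewrite F0 ?h.
rewrite big_ltn; last by lia.
rewrite big_ltn; last by lia.
rewrite big_ltn; last by lia.
rewrite big_nat_cond big1 ?addr0 ?addrA//.
by move=> i /andP[/andP[h _] _]; rewrite F0 ?h ?orbT.
Qed.

Section rows.
Context (R : realType).
Variables (g : R -> R) (a M B : R).

(** The periodized row, truncated to the translates by nB with |n| <= L; the
index i stands for n + L. *)
Definition row (L : nat) (f : R -> R) (k : int) (x : R) : R :=
  \sum_(0 <= i < L + L.+1) f (x + (i%:R - L%:R) * B) * g (x + (i%:R - L%:R) * B - k%:~R * a).

(** The number t of steps of the chain is such that t (B - a) >= a, so that the
position of the moving point, which starts in [0, a), has become small enough. *)
Lemma row_lower_bound : 0 < a -> a < M -> M < B -> continuous g ->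
  (forall x, g (- x) = g x) -> (forall x, M <= `|x| -> g x = 0) ->
  (forall x, `|x| < M -> 0 < g x) ->
  (forall x y, `|x| < `|y| -> `|x| < M -> g y < g x) ->
  exists t, exists2 C, 0 < C & forall f k p, k%:~R * a <= p -> p < (k + 1)%:~R * a ->
    f p ^+ 2 <= C * \sum_(j < t.+1) row t.+1 f (k - j%:Z) p ^+ 2.
Proof.
move=> a0 aM MB gC gN g0 gpos gmono.
have Ba : 0 < B - a by lra.
have [t ht] : exists t : nat, a <= t%:R * (B - a).
  exists (Num.truncn (a / (B - a))).+1.
  by rewrite -ler_pdivrMr//; apply: ltW; exact: truncnS_gt.
have [C C0 HC] := chain_bound a0 aM MB gC gN g0 gpos gmono t.
exists t; exists C => // f k p kp pk.
pose z := p - k%:~R * a.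
have z0 : 0 <= z by rewrite subr_ge0.
have za : z < a by rewrite /z; move: pk; rewrite intrD mulrDl mul1r; lra.
have HH := HC z (fun i => f (p - i%:R * B)) (fun j => row t.+1 f (k - j%:Z) p) z0 za.
move: HH; rewrite /= mul0r subr0; apply; first lra.
have far (w : R) (x : R) : a - M < w -> w < a -> x <= -2 \/ 2 <= x -> g (w + x * B) = 0.
  move=> w1 w2 [x2|x2].
    have : x * B <= -2 * B by rewrite ler_wpM2r//; lra.
    by move=> h; apply: g0; rewrite ler0_norm; lra.
  have : 2 * B <= x * B by rewrite ler_wpM2r//; lra.
  by move=> h; apply: g0; rewrite ger0_norm; lra.
have rowE (j : nat) (n : nat) : (n.+1 = t.+1 - j)%N -> (j <= t)%N -> a - M < z - j%:R * (B - a) ->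
  row t.+1 f (k - j%:Z) p = f (p + (- j%:R - 1) * B) * g (z - j%:R * (B - a) - B) +
    f (p - j%:R * B) * g (z - j%:R * (B - a)) +
    f (p + (1 - j%:R) * B) * g (z - j%:R * (B - a) + B).
  move=> nE jt zj.
  have nR : n%:R = t%:R - j%:R :> R by rewrite -natrB//; congr _%:R; lia.
  have kj : (k - j%:Z)%:~R = k%:~R - j%:R :> R by rewrite intrB.
  rewrite /row (@big_nat_window3 _ _ n).
  - rewrite kj -!natr1 nR; congr (f _ * g _ + f _ * g _ + f _ * g _); rewrite /z; ring.
  - lia.
  - move=> i hi; rewrite kj.
    rewrite [X in g X](_ : _ = z - j%:R * (B - a) + (i%:R - n%:R - 1) * B); last first.
      by rewrite nR -natr1 /z; ring.
    rewrite far ?mulr0//.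
      have : 0 <= j%:R * (B - a) by rewrite mulr_ge0// ltW.
      lra.
    case/orP: hi => hi; [left|right].
      have : i%:R + 1 <= n%:R :> R by rewrite natr1 ler_nat.
      lra.
    have : n%:R + 1 + 1 + 1 <= i%:R :> R by rewrite !natr1 ler_nat.
    lra.
split.
  rewrite (rowE 0%N t)//; last by rewrite mul0r subr0; lra.
  rewrite !mul0r !subr0 (g0 (z + B)) ?mulr0 ?addr0; last by rewrite ger0_norm; lra.
  by rewrite addrC; congr (_ + f _ * _); ring.
move=> j jt zj; rewrite (rowE j.+1 (t - j.+1)%N)//; last by lia.
rewrite addrC [X in _ + X]addrC addrA; congr (f _ * _ + _ + f _ * _); rewrite -!natr1; ring.
Qed.

End rows.

(** * Frame bounds *)

Lemma le_esumZ (R : realType) (I : choiceType) (S : set I) (c : R) (e : I -> \bar R) :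
  0 <= c -> (forall i, S i -> (0 <= e i)%E) ->
  (\esum_(i in S) (c%:E * e i) <= c%:E * \esum_(i in S) e i)%E.
Proof.
move=> c0 e0; apply: ge_ereal_sup => _ [A [fA AS] <-].
rewrite fsbig_finite//= big_seq -ge0_sume_distrr; last first.
  by move=> i; rewrite in_fset_set// => /set_mem /AS; exact: e0.
rewrite lee_wpmul2l// -big_seq; apply: esum_ge; exists A => //.
by rewrite fsbig_finite.
Qed.

Lemma esum_shift_int (R : realType) (e : int -> \bar R) (z : int) :
  (\esum_(k in [set: int]) e (k + z)%R = \esum_(k in [set: int]) e k)%E.
Proof.
rewrite (@reindex_esum _ _ _ [set: int] [set: int] (fun k => k + z) e)//.
split => //; first by move=> x y _ _; exact: addIr.
by move=> y _; exists (y - z) => //; rewrite subrK.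
Qed.

Section cells.
Context (R : realType).
Notation mu := (@lebesgue_measure R).
Variables (a : R) (h : measurableTypeR R -> \bar R).
Hypotheses (a0 : 0 < a) (mh : measurable_fun setT h) (h0 : forall x, (0 <= h x)%E).

(** Cells tile the line, and the energy at k is compared with the integral over the
cells near the k-th one. *)
Definition cell (k : int) : set (measurableTypeR R) := `[(k%:~R * a), ((k + 1)%:~R * a)[%classic.

Lemma measurable_cell k : measurable (cell k).
Proof. exact: measurable_itv. Qed.

Lemma cell_inj k l x : cell k x -> cell l x -> k = l.
Proof.
rewrite /cell /= !in_itv/= => /andP[k1 k2] /andP[l1 l2].
have := le_lt_trans k1 l2; have := le_lt_trans l1 k2.
by rewrite !ltr_pM2r// !ltr_int; lia.
Qed.

Lemma integral_cells (m : int) (n : nat) :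
  (\int[mu]_(x in `[(m%:~R * a)%R, ((m + n%:Z)%:~R * a)%R[) h x =
   \sum_(0 <= i < n) \int[mu]_(x in cell (m + i%:Z)) h x)%E.
Proof.
elim: n => [|n IH]; first by rewrite addr0 set_itvco0 integral_set0 big_geq.
rewrite big_nat_recr//= -IH.
have e : (m + n.+1%:Z) = m + n%:Z + 1 by lia.
have a1 := a0.
have U : `[(m%:~R * a), ((m + n.+1%:Z)%:~R * a)[%classic =
    `[(m%:~R * a), ((m + n%:Z)%:~R * a)[%classic `|` cell (m + n%:Z).
  have mn : m%:~R * a <= (m + n%:Z)%:~R * a by rewrite ler_pM2r// ler_int lerDl.
  have mn' : (m + n%:Z)%:~R * a <= (m + n.+1%:Z)%:~R * a by rewrite ler_pM2r// ler_int e lerDl.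
  apply/seteqP; split => x; rewrite /cell /= -e !in_itv/=.
    by move=> /andP[x1 x2]; case: (ltP x ((m + n%:Z)%:~R * a)) => hx; [left|right]; rewrite ?x1.
  move=> [] /andP[x1 x2]; apply/andP; split => //.
    exact: lt_le_trans x2 mn'.
  exact: le_trans mn x1.
rewrite U ge0_integral_setU//; try by [exact: measurable_itv|exact: measurable_cell|exact: measurable_funTS].
apply/disj_set2P; rewrite -subset0 => x [] /=; rewrite /cell /= !in_itv/= => /andP[_ x1] /andP[x2 _].
by have := lt_le_trans x1 x2; rewrite ltxx.
Qed.

Lemma esum_cells :
  (\esum_(k in [set: int]) \int[mu]_(x in cell k) h x = \int[mu]_x h x)%E.
Proof.
apply/eqP; rewrite eq_le; apply/andP; split.
  apply: ge_ereal_sup => _ [A [fA _] <-].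
  have tA : trivIset [set` fset_set A] cell.
    by apply/trivIsetP => k l _ _ kl; rewrite -subset0 => x [kx lx]; move/eqP: kl; apply; exact: cell_inj kx lx.
  have mU : measurable (\big[setU/set0]_(k <- fset_set A) cell k).
    by apply: bigsetU_measurable => k _; exact: measurable_cell.
  rewrite fsbig_finite//= -(ge0_integral_bigsetU mu measurable_cell (fset_uniq _) tA)//.
    exact: ge0_subset_integral.
  exact: measurable_funTS.
pose F (n : nat) : set (measurableTypeR R) := `[((- n%:Z)%:~R * a), ((- n%:Z + (n + n)%:Z)%:~R * a)[%classic.
have FT : \bigcup_n F n = setT.
  apply/seteqP; split => // x _.
  exists (Num.truncn (`|x| / a)).+1 => //.
  rewrite /F /= in_itv/=.
  set n := (Num.truncn _).+1.
  have xn : `|x| < n%:R * a by rewrite -ltr_pdivrMr//; exact: truncnS_gt.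
  rewrite PoszD addrA addNr add0r intrN mulNr.
  by move: xn; rewrite ltr_norml => /andP[x1 x2]; rewrite (ltW x1) x2.
rewrite -FT.
have := @ge0_nondecreasing_set_cvg_integral _ _ _ F h mu.
move=> H; have {}H : (\int[mu]_(x in F i) h x @[i --> \oo] --> \int[mu]_(x in \bigcup_i F i) h x)%E.
  apply: H => //.
  - move=> n m nm; rewrite subsetEset /F => x /=; rewrite !in_itv/= !PoszD !addrA !addNr !add0r.
    move=> /andP[x1 x2]; apply/andP; split.
      by apply: le_trans x1; rewrite ler_pM2r// ler_int; lia.
    by apply: (lt_le_trans x2); rewrite ler_pM2r// ler_int; lia.
  - by move=> i; exact: measurable_itv.
  - by move=> i; exact: measurable_funTS.
rewrite -(cvg_lim _ H)//; apply: lime_le; first by apply/cvg_ex; eexists; exact: H.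
apply: nearW => n; rewrite /F integral_cells.
apply: esum_ge; exists [set` [seq (- n%:Z + i%:Z) | i <- iota 0 (n + n)]].
  by split => //; exact: finite_seq.
rewrite -fsbig_seq; last by rewrite map_inj_uniq ?iota_uniq// => i j; lia.
by rewrite big_map /index_iota subn0.
Qed.

End cells.

Lemma ge0_sum_cst (R : realType) (n : nat) (x : \bar R) :
  (0 <= x)%E -> (\sum_(0 <= i < n) x = n%:R%:E * x)%E.
Proof.
move=> x0; elim: n => [|n IH]; first by rewrite big_geq// mul0e.
by rewrite big_nat_recr//= IH -natr1 EFinD ge0_muleDl ?lee_fin// mul1e.
Qed.

Section complex_reduction.
Context (R : realType).
Notation mu := (@lebesgue_measure R).
Implicit Types f : R -> R[i].

Definition re_part f : measurableTypeR R -> R := fun x => complex.Re (f x).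
Definition im_part f : measurableTypeR R -> R := fun x => complex.Im (f x).

Lemma L2norm_sqr f : cmeasurable f ->
  (L2norm f ^+ 2 = \int[mu]_x (re_part f x ^+ 2)%:E + \int[mu]_x (im_part f x ^+ 2)%:E)%E.
Proof.
move=> [mr mi].
have -> : (L2norm f ^+ 2 = L2norm f `^ 2)%E.
  have := Lnorm_ge0 mu 2%:E (EFin \o (fun x => Normc.normc (f x))); rewrite -/(L2norm f).
  case: (L2norm f) => [r| |] r0 //; first by rewrite poweR_EFin powR_mulrn.
  by rewrite poweRyr// expe2 mulyy.
rewrite poweR_Lnorm// -ge0_integralD//.
- apply: eq_integral => x _.
  rewrite /re_part /im_part /= -EFinD; case: (f x) => u v /=.
  by rewrite ger0_norm ?sqrtr_ge0// powR_mulrn ?sqrtr_ge0// sqr_sqrtr// addr_ge0 ?sqr_ge0.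
- by move=> x _; rewrite lee_fin sqr_ge0.
- by apply/measurable_EFinP; apply: measurable_funX; exact: mr.
- by move=> x _; rewrite lee_fin sqr_ge0.
- by apply/measurable_EFinP; apply: measurable_funX; exact: mi.
Qed.

Lemma in_L2_sqint f : in_L2 f -> sqint mu setT (re_part f) /\ sqint mu setT (im_part f).
Proof.
move=> [cf]; have [mr mi] := cf => fin.
have : (L2norm f ^+ 2 < +oo)%E.
  have := Lnorm_ge0 mu 2%:E (EFin \o (fun x => Normc.normc (f x))); rewrite -/(L2norm f).
  by case: (L2norm f) fin => [r| |] // _ _; rewrite expe2 -EFinM ltry.
rewrite L2norm_sqr//.
have i0 (w : measurableTypeR R -> R) : (0 <= \int[mu]_x (w x ^+ 2)%:E)%E.
  by apply: integral_ge0 => x _; rewrite lee_fin sqr_ge0.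
have split2 (w : measurableTypeR R -> R) : measurable_fun setT w ->
    (\int[mu]_x (w x ^+ 2)%:E < +oo)%E -> sqint mu setT w.
  move=> mw fw; split=> //; apply/integrableP; split.
    by apply/measurable_EFinP; exact: measurable_funX.
  by under eq_integral do rewrite /= ger0_norm ?sqr_ge0//.
move=> h; split; apply: split2 => //.
  by apply: le_lt_trans h; rewrite leeDl.
by apply: le_lt_trans h; rewrite leeDr.
Qed.

End complex_reduction.

Section gabor_bounds.
Context (R : realType).
Notation mu := (@lebesgue_measure R).
Variables (g : R -> R) (a M b : R).
Hypotheses (a0 : 0 < a) (aM : a < M) (b0 : 0 < b) (MB : M < b^-1).
Hypothesis gC : continuous g.
Hypothesis gN : forall x, g (- x) = g x.
Hypothesis g0 : forall x, M <= `|x| -> g x = 0.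
Hypothesis gpos : forall x, `|x| < M -> 0 < g x.
Hypothesis gmono : forall x y, `|x| < `|y| -> `|x| < M -> g y < g x.
Local Notation B := (b^-1).

Definition windowed (f : measurableTypeR R -> R) (k : int) (x : measurableTypeR R) : R :=
  f x * g (x - k%:~R * a).

Lemma window_le_g0 x : `|g x| <= g 0.
Proof.
by rewrite ger0_norm ?(window_ge0 g0 gpos)// (window_le gN g0 gmono)// normr0.
Qed.

Lemma measurable_windowed f k : measurable_fun setT f -> measurable_fun setT (windowed f k).
Proof.
move=> mf; apply: measurable_funM => //.
apply: (@measurable_fun_shift R (- (k%:~R * a)) g).
by apply: continuous_measurable_fun.
Qed.

Lemma windowed_sqr_le f k x : windowed f k x ^+ 2 <= g 0 ^+ 2 * f x ^+ 2.
Proof.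
rewrite /windowed exprMn mulrC ler_wpM2r ?sqr_ge0//.
have h := window_le_g0 (x - k%:~R * a).
rewrite -(real_normK (num_real (g _))) lerXn2r// nnegrE//; apply: le_trans h => //.
Qed.

Lemma sqint_windowed f k : sqint mu setT f -> sqint mu setT (windowed f k).
Proof.
move=> sf; have [mf _] := sf.
have mw := measurable_windowed k mf.
split=> //.
have [_ i2] := sqintZ measurableT (g 0) sf.
apply: (le_integrable measurableT _ _ i2).
  by apply/measurable_EFinP; exact: measurable_funX.
move=> x _ /=; rewrite lee_fin !ger0_norm ?sqr_ge0// [leRHS]exprMn.
exact: windowed_sqr_le.
Qed.

(** The support of g(x - ka) lies in an interval of length 2B around ka, where
Bessel's inequality applies since b (2B) = 2. *)
Lemma local_upper f k : sqint mu setT f ->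
  (\esum_(l in [set: int]) (line_energy b (windowed f k) l)%:E <=
   (2 * B * g 0 ^+ 2)%:E * \int[mu]_(x in `[(k%:~R * a - B)%R, (k%:~R * a - B + 2 * B)%R[) (f x ^+ 2)%:E)%E.
Proof.
move=> sf; have h1 := MB.
pose c := k%:~R * a - B.
have mE : @measurable _ (measurableTypeR R) `[c, c + 2 * B[%classic by exact: measurable_itv.
have B0 : 0 < B by rewrite invr_gt0.
have sE : sqint mu `[c, c + 2 * B[ (windowed f k).
  by apply: sqintS (sqint_windowed k sf).
apply: (@le_trans _ _ (2 * B * ip mu `[c, c + 2 * B[ (windowed f k) (windowed f k))%:E).
  apply: (@esum_bessel _ _ _ _ 2) => //.
  - by rewrite mulr_gt0.
  - by rewrite mulrCA divff ?mulr1// gt_eqF.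
  - move=> x /= /negP; rewrite in_itv/= negb_and -ltNge -leNgt /windowed /c => h.
    rewrite g0 ?mulr0//; case/orP: h => h.
      by rewrite ler0_norm; lra.
    by rewrite ger0_norm; lra.
have sfE : sqint mu `[c, c + 2 * B[ f by apply: sqintS sf.
rewrite (EFinM (2 * B) (ip _ _ _ _)) (EFinM (2 * B) (g 0 ^+ 2)) -muleA.
rewrite lee_pmul2l ?lte_fin ?mulr_gt0//.
rewrite EFin_ip// -ge0_integralZl//; last 3 first.
- by apply/measurable_EFinP; apply: measurable_funX; case: sfE.
- by move=> x _; rewrite lee_fin sqr_ge0.
- by rewrite lee_fin sqr_ge0.
apply: ge0_le_integral => //.
- by move=> x _; rewrite lee_fin sqr_ge0.
- by apply/measurable_EFinP; apply: measurable_funX; case: sE.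
- by apply/measurable_EFinP; apply: measurable_funM => //; apply: measurable_funX; case: sfE.
- move=> x _; rewrite -EFinM lee_fin; exact: windowed_sqr_le.
Qed.

(** The cell has length a < B, so the integral of each squared row over it is at
most its integral over a period, which Parseval's inequality bounds by an energy. *)
Lemma local_lower : exists t, exists2 C : R, 0 < C & forall f k, sqint mu setT f ->
  (\int[mu]_(x in `[(k%:~R * a)%R, ((k + 1)%:~R * a)%R[) (f x ^+ 2)%:E <=
   C%:E * \sum_(j < t.+1) \esum_(l in [set: int]) (line_energy b (windowed f (k - j%:Z)) l)%:E)%E.
Proof.
have [t [C C0 HC]] := row_lower_bound a0 aM MB gC gN g0 gpos gmono.
have h1 := MB; have h2 := aM; have h3 := a0.
have B0 : 0 < B by rewrite invr_gt0.
have bB : b * B = 1 by rewrite divff// gt_eqF.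
exists t; exists (C * b); first by rewrite mulr_gt0.
move=> f k sf.
pose s := k%:~R * a.
pose r j := row g a B t.+1 f (k - j%:Z).
have rE j : r j = fun x => \sum_(0 <= i < t.+1 + t.+2) windowed f (k - j%:Z) (x + (i%:R - t.+1%:R) * B) by [].
have sr j : sqint mu setT (r j).
  by rewrite rE; apply: sqint_sum => // i; apply: sqint_shift; exact: sqint_windowed.
have mD : @measurable _ (measurableTypeR R) `[s, s + B[%classic by exact: measurable_itv.
have mA : @measurable _ (measurableTypeR R) `[s, ((k + 1)%:~R * a)[%classic by exact: measurable_itv.
have mr j : measurable_fun setT (fun x => (r j x ^+ 2)%:E).
  by apply/measurable_EFinP; apply: measurable_funX; case: (sr j).
have par j : (\int[mu]_(x in `[s, ((k + 1)%:~R * a)%R[) (r j x ^+ 2)%:E <=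
   b%:E * \esum_(l in [set: int]) (line_energy b (windowed f (k - j%:Z)) l)%:E)%E \/ (t < j)%N.
  have [jt|jt] := ltnP t j; [by right|left].
  have srD : sqint mu `[s, s + B[ (r j) by apply: sqintS (sr j).
  apply: (@le_trans _ _ (\int[mu]_(x in `[s, (s + B)%R[) (r j x ^+ 2)%:E)%E).
    apply: ge0_subset_integral => //.
    - by apply: measurable_funTS; exact: mr.
    - by move=> x _; rewrite lee_fin sqr_ge0.
    - move=> x /=; rewrite !in_itv/= => /andP[-> /=] h; apply: lt_le_trans h _.
      by rewrite /s intrD mulrDl mul1r lerD2l; lra.
  rewrite -EFin_ip//; apply: (le_trans (parseval_le b0 B0 bB _ srD)); first by case: (sr j).
  rewrite invrK lee_pmul2l ?lte_fin//; apply: le_esum => l _.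
  rewrite lee_fin (@line_energy_fold _ b B s t.+1 (windowed f (k - j%:Z)))//.
    exact: sqint_windowed.
  have jt' : j%:R <= t%:R :> R by rewrite ler_nat.
  have tB : j%:R * a <= t%:R * B by apply: ler_pM => //; lra.
  have tB0 : 0 <= j%:R * a by rewrite mulr_ge0// ltW.
  move=> x /= /negP; rewrite in_itv/= negb_and -ltNge -leNgt /windowed intrB => h.
  rewrite g0 ?mulr0//; move: h; rewrite natrD -!natr1 /s; case/orP => h.
    by rewrite ler0_norm; lra.
  by rewrite ger0_norm; lra.
apply: (@le_trans _ _ (\int[mu]_(x in `[s, ((k + 1)%:~R * a)%R[) (C%:E * \sum_(j < t.+1) (r j x ^+ 2)%:E))%E).
  apply: ge0_le_integral => //.
  - by move=> x _; rewrite lee_fin sqr_ge0.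
  - by apply/measurable_EFinP; apply: measurable_funX; apply: measurable_funTS; case: sf.
  - apply: measurable_funTS; apply: emeasurable_funM => //; apply: emeasurable_sum => j; exact: mr.
  - move=> x /=; rewrite in_itv/= => /andP[x1 x2].
    by rewrite sumEFin -EFinM lee_fin; exact: HC.
rewrite ge0_integralZl//; last 3 first.
- apply: measurable_funTS; apply: emeasurable_sum => j; exact: mr.
- by move=> x _; apply: sume_ge0 => j _; rewrite lee_fin sqr_ge0.
- by rewrite lee_fin ltW.
rewrite EFinM -muleA lee_pmul2l ?lte_fin//.
rewrite ge0_integral_sum//; last 2 first.
- by move=> j; apply: measurable_funTS; exact: mr.
- by move=> j x _; rewrite lee_fin sqr_ge0.
rewrite ge0_sume_distrr; last first.
  by move=> j _; apply: esum_ge0 => l _; rewrite lee_fin addr_ge0 ?sqr_ge0.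
apply: lee_sum => j _; case: (par j) => //.
by rewrite ltnNge -ltnS ltn_ord.
Qed.

Definition gabor_energy (f : measurableTypeR R -> R) (k : int) : \bar R :=
  (\esum_(l in [set: int]) (line_energy b (windowed f k) l)%:E)%E.

Lemma gabor_energy_ge0 f k : (0 <= gabor_energy f k)%E.
Proof. by apply: esum_ge0 => l _; rewrite lee_fin addr_ge0 ?sqr_ge0. Qed.

Let measurable_sqr f : sqint mu setT f -> measurable_fun setT (fun x => (f x ^+ 2)%:E).
Proof. by move=> [mf _]; apply/measurable_EFinP; exact: measurable_funX. Qed.

(** The interval of [local_upper] is covered by 2J cells, where J a >= B, so each
cell is counted 2J times in the sum over k. *)
Lemma global_upper : exists2 K : R, 0 < K & forall f, sqint mu setT f ->
  (\esum_(k in [set: int]) gabor_energy f k <= K%:E * \int[mu]_x (f x ^+ 2)%:E)%E.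
Proof.
have B0 : 0 < B by rewrite invr_gt0.
have [J hJ] : exists J : nat, B <= J%:R * a.
  exists (Num.truncn (B / a)).+1.
  by rewrite -ler_pdivrMr//; apply: ltW; exact: truncnS_gt.
pose K := 2 * B * g 0 ^+ 2.
have G0 : 0 < g 0 by apply: gpos; rewrite normr0 (lt_trans a0 aM).
have K0 : 0 < K by rewrite !mulr_gt0 ?exprn_gt0.
have J0 : (0 < J)%N.
  by rewrite lt0n; apply/eqP => J0; move: hJ; rewrite J0 mul0r leNgt B0.
exists (K * (J + J)%:R); first by rewrite mulr_gt0// ltr0n addn_gt0 J0.
move=> f sf.
pose m k := (\int[mu]_(x in cell a k) (f x ^+ 2)%:E)%E.
have m0 k : (0 <= m k)%E by apply: integral_ge0 => x _; rewrite lee_fin sqr_ge0.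
have mE : (\esum_(k in [set: int]) m k = \int[mu]_x (f x ^+ 2)%:E)%E.
  by apply: esum_cells => //; [exact: measurable_sqr|move=> x; rewrite lee_fin sqr_ge0].
have up k : (gabor_energy f k <= K%:E * \sum_(0 <= i < J + J) m (k + (i%:Z - J%:Z))%R)%E.
  rewrite /gabor_energy; have := local_upper k sf; move=> /le_trans; apply.
  rewrite lee_pmul2l ?lte_fin//.
  apply: (@le_trans _ _ (\int[mu]_(x in `[((k - J%:Z)%:~R * a)%R, ((k - J%:Z + (J + J)%:Z)%:~R * a)%R[) (f x ^+ 2)%:E)%E).
    apply: ge0_subset_integral; try exact: measurable_itv.
    - by apply: measurable_funTS; exact: measurable_sqr.
    - by move=> x _; rewrite lee_fin sqr_ge0.
    - move=> x /=; rewrite !in_itv/= PoszD addrA subrK !intrD intrN !mulrDl mulNr => /andP[x1 x2].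
      by apply/andP; split; move: hJ x1 x2; rewrite -[J%:~R]/(J%:R : R); lra.
  rewrite integral_cells//; last 2 first.
  - exact: measurable_sqr.
  - by move=> x; rewrite lee_fin sqr_ge0.
  by apply: lee_sum => i _; rewrite -addrA (addrC (- J%:Z)).
apply: (@le_trans _ _ (\esum_(k in [set: int]) (K%:E * \sum_(0 <= i < J + J) m (k + (i%:Z - J%:Z))%R))%E).
  by apply: le_esum => k _; exact: up.
apply: (le_trans (le_esumZ (ltW K0) _)).
  by move=> k _; apply: sume_ge0.
rewrite (EFinM K) -muleA lee_pmul2l ?lte_fin//.
rewrite esum_sum//; under eq_bigr do rewrite esum_shift_int mE.
rewrite ge0_sum_cst//; apply: integral_ge0 => x _; by rewrite lee_fin sqr_ge0.
Qed.

(** In the sum over k each energy is counted t + 1 times. *)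
Lemma global_lower : exists2 C : R, 0 < C & forall f, sqint mu setT f ->
  (\int[mu]_x (f x ^+ 2)%:E <= C%:E * \esum_(k in [set: int]) gabor_energy f k)%E.
Proof.
have [t [C C0 H]] := local_lower.
exists (C * t.+1%:R); first by rewrite mulr_gt0.
move=> f sf.
have mE : (\esum_(k in [set: int]) \int[mu]_(x in cell a k) (f x ^+ 2)%:E = \int[mu]_x (f x ^+ 2)%:E)%E.
  by apply: esum_cells => //; [exact: measurable_sqr|move=> x; rewrite lee_fin sqr_ge0].
rewrite -mE.
apply: (@le_trans _ _ (\esum_(k in [set: int]) (C%:E * \sum_(j < t.+1) gabor_energy f (k - j%:Z)%R))%E).
  by apply: le_esum => k _; exact: H.
apply: (le_trans (le_esumZ (ltW C0) _)).
  by move=> k _; apply: sume_ge0 => j _; exact: gabor_energy_ge0.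
rewrite EFinM -muleA lee_pmul2l ?lte_fin//.
rewrite esum_sum//; last by move=> *; exact: gabor_energy_ge0.
under eq_bigr => j _ do rewrite (esum_shift_int (gabor_energy f) (- j%:Z)).
rewrite -(big_mkord xpredT (fun=> _)) ge0_sum_cst//.
by apply: esum_ge0 => k _; exact: gabor_energy_ge0.
Qed.

Let coefC (w : measurableTypeR R -> R) l k := line_coef b (windowed w k) l 0.
Let coefS (w : measurableTypeR R -> R) l k := line_coef b (windowed w k) l (- (pi / 2)).

Let integrable_windowed w k l phi : sqint mu setT w ->
  mu.-integrable setT (EFin \o (fun x => windowed w k x * wave b l phi x)).
Proof.
move=> sw; apply: (@integrable_line _ b (k%:~R * a - M) (2 * M)).
  exact: (sqint_windowed).
move=> x /= /negP; rewrite in_itv/= negb_and -ltNge -leNgt /windowed => h.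
rewrite g0 ?mulr0//; have h1 := a0; have h2 := aM; case/orP: h => h.
  by rewrite ler0_norm; lra.
by rewrite ger0_norm; lra.
Qed.

(** With C and S the cosine and sine coefficients, the inner product is
(C u + S v) + i (C v - S u). *)
Lemma gabor_inner_sqr f l k : in_L2 f ->
  Normc.normc (L2inner f (gabor_system (fun x => (g x)%:C) a b (l, k))) ^+ 2 =
  (coefC (re_part f) l k + coefS (im_part f) l k) ^+ 2 +
  (coefC (im_part f) l k - coefS (re_part f) l k) ^+ 2.
Proof.
move=> /in_L2_sqint[su sv].
have -> : L2inner f (gabor_system (fun x => (g x)%:C) a b (l, k)) =
   (coefC (re_part f) l k + coefS (im_part f) l k) +i*
   (coefC (im_part f) l k - coefS (re_part f) l k).
  rewrite /L2inner /cintegral.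
  have -> : (fun x => complex.Re (f x * (gabor_system (fun x => (g x)%:C) a b (l, k) x)^*)) =
    fun x => windowed (re_part f) k x * wave b l 0 x +
             windowed (im_part f) k x * wave b l (- (pi / 2)) x.
    apply/funext => x; rewrite /gabor_system /windowed /wave /cexpi /re_part /im_part addr0 cosBpihalf.
    by case: (f x) => u v /=; ring.
  have -> : (fun x => complex.Im (f x * (gabor_system (fun x => (g x)%:C) a b (l, k) x)^*)) =
    fun x => windowed (im_part f) k x * wave b l 0 x -
             windowed (re_part f) k x * wave b l (- (pi / 2)) x.
    apply/funext => x; rewrite /gabor_system /windowed /wave /cexpi /re_part /im_part addr0 cosBpihalf.
    by case: (f x) => u v /=; ring.
  by rewrite RintegralD ?RintegralB//; exact: integrable_windowed.
by rewrite /= sqr_sqrtr// addr_ge0 ?sqr_ge0.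
Qed.

Lemma coefCN w l k : coefC w (- l) k = coefC w l k.
Proof.
apply: eq_Rintegral => x _; congr (_ * _).
by rewrite /wave !addr0 mulrNz mulrN !mulNr cosN.
Qed.

Lemma coefSN w l k : sqint mu setT w -> coefS w (- l) k = - coefS w l k.
Proof.
move=> sw; rewrite -[RHS]mulN1r -RintegralZl//; last exact: integrable_windowed.
apply: eq_Rintegral => x _.
by rewrite /wave !cosBpihalf mulrNz mulrN !mulNr sinN mul1r mulrN.
Qed.

Lemma esum_energy w :
  (\esum_(lk in [set: int * int]) (line_energy b (windowed w lk.2) lk.1)%:E =
   \esum_(k in [set: int]) gabor_energy w k)%E.
Proof.
rewrite /gabor_energy esum_esum; last by move=> k l _ _; rewrite lee_fin addr_ge0 ?sqr_ge0.
rewrite (_ : [set: int] `*`` (fun=> [set: int]) = [set: int * int]); last exact/seteqP.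
apply: (@reindex_esum _ _ _ [set: int * int] _ (fun kl => (kl.2, kl.1))).
split => //.
- by move=> [? ?] [? ?] _ _ [-> ->].
- by move=> [k l] _; exists (l, k).
Qed.

(** Replacing l by - l changes the sign of S and leaves C unchanged, so the mean
of the squared coefficients at l and - l is (C u)^2 + (S u)^2 + (C v)^2 + (S v)^2. *)
Lemma gabor_frame_window : gabor_frame (fun x => (g x)%:C) a b.
Proof.
have [K K0 HK] := global_upper.
have [C C0 HC] := global_lower.
exists C^-1, (2 * K); split; [by rewrite invr_gt0|by rewrite mulr_gt0|].
move=> f lf; have [su sv] := in_L2_sqint lf.
rewrite L2norm_sqr; last by case: lf.
pose u := re_part f; pose v := im_part f.
rewrite -/u -/v in su sv *.
pose E (w : measurableTypeR R -> R) (lk : int * int) :=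
  (line_energy b (windowed w lk.2) lk.1)%:E.
have E0 w lk : (0 <= E w lk)%E by rewrite lee_fin addr_ge0 ?sqr_ge0.
pose q (lk : int * int) := (coefC u lk.1 lk.2 + coefS v lk.1 lk.2) ^+ 2 +
  (coefC v lk.1 lk.2 - coefS u lk.1 lk.2) ^+ 2.
have q0 lk : 0 <= q lk by rewrite addr_ge0 ?sqr_ge0.
rewrite (@eq_esum _ _ _ _ (fun lk => (q lk)%:E)); last first.
  by move=> [l k] _; rewrite gabor_inner_sqr.
split.
  have T1 : (\int[mu]_x (u x ^+ 2)%:E + \int[mu]_x (v x ^+ 2)%:E <=
      C%:E * \esum_(lk in [set: int * int]) (E u lk + E v lk))%E.
    rewrite esumD// !esum_energy ge0_muleDr; last 2 first.
    - by apply: esum_ge0 => k _; exact: gabor_energy_ge0.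
    - by apply: esum_ge0 => k _; exact: gabor_energy_ge0.
    by apply: leeD; [exact: HC|exact: HC].
  pose neg (lk : int * int) := (- lk.1, lk.2).
  have qE lk : (E u lk + E v lk = (2^-1)%:E * (q lk)%:E + (2^-1)%:E * (q (neg lk))%:E)%E.
    rewrite -!EFinM -!EFinD; congr EFin.
    rewrite /q /neg /= !coefCN !coefSN// /line_energy -/(coefC _ _ _) -/(coefS _ _ _).
    by rewrite -/(coefC _ _ _) -/(coefS _ _ _); field.
  have T2 : (\esum_(lk in [set: int * int]) (E u lk + E v lk) <=
      \esum_(lk in [set: int * int]) (q lk)%:E)%E.
    rewrite (eq_esum (fun lk _ => qE lk)) esumD; last 2 first.
    - by move=> lk _; rewrite -EFinM lee_fin mulr_ge0.
    - by move=> lk _; rewrite -EFinM lee_fin mulr_ge0.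
    rewrite -(@reindex_esum _ _ _ [set: int * int] [set: int * int] neg (fun lk => (2^-1)%:E * (q lk)%:E)%E); last first.
      split => //.
      - by move=> [? ?] [? ?] _ _ [/oppr_inj -> ->].
      - by move=> [l k] _; exists (- l, k) => //; rewrite /neg /= opprK.
    have h2 : (0 : R) <= 2^-1 by [].
    have half : (\esum_(lk in [set: int * int]) ((2^-1)%:E * (q lk)%:E) <=
        (2^-1)%:E * \esum_(lk in [set: int * int]) (q lk)%:E)%E.
      by apply: le_esumZ => // lk _; rewrite lee_fin.
    apply: (le_trans (leeD half half)).
    rewrite -ge0_muleDl ?lee_fin// -EFinD (_ : 2^-1 + 2^-1 = 1 :> R) ?mul1e//; by field.
  apply: (@le_trans _ _ (C^-1%:E * (C%:E * \esum_(lk in [set: int * int]) (E u lk + E v lk)))%E).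
    by rewrite lee_pmul2l ?lte_fin ?invr_gt0.
  by rewrite muleA -EFinM mulVf ?gt_eqF// mul1e.
apply: (@le_trans _ _ (\esum_(lk in [set: int * int]) (2%:E * (E u lk + E v lk)))%E).
  apply: le_esum => lk _; rewrite -EFinD -EFinM lee_fin /q /line_energy -/(coefC _ _ _) -/(coefS _ _ _).
  rewrite -/(coefC v _ _) -/(coefS v _ _).
  have := sqr_ge0 (coefC u lk.1 lk.2 - coefS v lk.1 lk.2).
  have := sqr_ge0 (coefC v lk.1 lk.2 + coefS u lk.1 lk.2).
  by lra.
apply: le_trans (le_esumZ _ _) _ => //; first by move=> lk _; rewrite adde_ge0.
rewrite EFinM -muleA lee_pmul2l ?lte_fin// esumD// !esum_energy ge0_muleDr; last 2 first.
- by apply: integral_ge0 => x _; rewrite lee_fin sqr_ge0.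
- by apply: integral_ge0 => x _; rewrite lee_fin sqr_ge0.
by apply: leeD; [exact: HK|exact: HK].
Qed.

End gabor_bounds.

(** * The windows and the parameter region *)

Section window.
Context (R : realType).

(** A continuous function that does not vanish at x does not vanish at some
point further away from 0, so it vanishes at the ends of its support too. *)
Lemma closure_support_vanish (g : R -> R) (M : R) : continuous g ->
  closure [set x | g x != 0] `<=` `[- M, M]%classic ->
  forall x, M <= `|x| -> g x = 0.
Proof.
move=> gC sg x Mx; apply/eqP/negPn/negP => gx.
have near_r : \forall y \near x^'+, g y != 0.
  by apply: cvgr_neq0 gx; apply: cvg_at_right_filter; exact: gC.
have near_l : \forall y \near x^'-, g y != 0.
  by apply: cvgr_neq0 gx; apply: cvg_at_left_filter; exact: gC.
have [x0|x0] := leP 0 x.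
  have [y /andP[xy gy]] : exists y, (x < y) && (g y != 0).
    have : \forall y \near x^'+, (x < y) && (g y != 0).
      near=> y; apply/andP; split; first by near: y; exact: nbhs_right_gt.
      by near: y.
    by move/filter_ex.
  have /sg : closure [set x | g x != 0] y by exact: subset_closure.
  by rewrite /= in_itv/=; move: Mx; rewrite ger0_norm//; lra.
have [y /andP[xy gy]] : exists y, (y < x) && (g y != 0).
  have : \forall y \near x^'-, (y < x) && (g y != 0).
    near=> y; apply/andP; split; first by near: y; exact: nbhs_left_lt.
    by near: y.
  by move/filter_ex.
have /sg : closure [set x | g x != 0] y by exact: subset_closure.
by rewrite /= in_itv/=; move: Mx; rewrite ltr0_norm//; lra.
Unshelve. all: by end_near. Qed.

Lemma even_incr_window (g : R -> R) (M : R) :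
  (forall x, g (- x) = g x) -> {in `[- M, 0] &, {homo g : x y / x < y}} ->
  (forall x, M <= `|x| -> g x = 0) ->
  (forall x, `|x| < M -> 0 < g x) /\
  (forall x y, `|x| < `|y| -> `|x| < M -> g y < g x).
Proof.
move=> gN gi g0.
have gE x : g x = g (- `|x|) by rewrite gN; case: (leP 0 x) => h; [rewrite ger0_norm|rewrite ltr0_norm// gN].
have pos x : `|x| < M -> 0 < g x.
  move=> xM; have x0 := normr_ge0 x.
  rewrite gE -(g0 (- M)); last by rewrite normrN ler_norm.
  by apply: gi; rewrite ?in_itv/=; lra.
split=> // x y xy xM; case: (leP M `|y|) => [yM|yM]; first by rewrite (g0 _ yM) pos.
have x0 := normr_ge0 x.
by rewrite (gE x) (gE y); apply: gi; rewrite ?in_itv/=; lra.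
Qed.

Lemma T_region_bounds (N a b : R) : 0 < N -> T_region N (a, b) -> a < N / 2 /\ N / 2 < b^-1.
Proof.
move=> N0 [m _]; rewrite /T_part.
have fin : 0 < b -> b < 2 / N -> N / 2 < b^-1.
  by move=> b0 bN; rewrite -[N / 2]invf_div ltf_pV2 ?posrE// divr_gt0.
by case: ifP => _ /= [_ b0 + _ bN]; rewrite in_itv/= => /andP[_ aN]; split => //; exact: fin.
Qed.
End window.

Theorem corollary1 (R : realType) (a N : R) (ha : 0 < a) (hN : 2 <= N)
    (g : R -> R) (hg : V_window N a g) (b : R) (hb : 0 < b) (hT : T_region N (a, b)) :
  gabor_frame (fun x => (g x)%:C) a b.
Proof.
have [gC gS gN gi _] := hg.
have N0 : 0 < N by apply: lt_le_trans hN.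
have [aM MB] := T_region_bounds N0 hT.
have g0 : forall x, N / 2 <= `|x| -> g x = 0.
  by apply: closure_support_vanish => //; rewrite gS.
have [gpos gmono] := even_incr_window gN gi g0.
exact: (gabor_frame_window ha aM hb MB gC gN g0 gpos gmono).
Qed.
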